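(* Let $n\ge 3$ and $T_n=\{(a,b,c)\in\mathbb N^3 : 1\le a<b<c\le n\}$. For every $M\in N_n^+$, the following chain of identities holds (all twelve sums below are equal to each other): $$\sum_{(a,b,c)\in T_n} l\bigl(Y_{abc}(M')\bigr)=\sum_{(a,b,c)\in T_n} l\Bigl(\frac{1}{Y_{abc}(M)}\Bigr)=\sum_{(a,b,c)\in T_n} l\bigl(Y_{abc}(M'')\bigr)$$ $$=\sum_{(a,b,c)\in T_n} l\bigl(\tilde Y^{abc}(M')\bigr)=\sum_{(a,b,c)\in T_n} l\Bigl(\frac{1}{\tilde Y^{abc}(M)}\Bigr)=\sum_{(a,b,c)\in T_n} l\bigl(\tilde Y^{abc}(M'')\bigr)$$ $$=\sum_{(a,b,c)\in T_n} l\bigl(\tilde Y_{abc}(M')\bigr)=\sum_{(a,b,c)\in T_n} l\Bigl(\frac{1}{\tilde Y_{abc}(M)}\Bigr)=\sum_{(a,b,c)\in T_n} l\bigl(\tilde Y_{abc}(M'')\bigr)$$ $$=\sum_{(a,b,c)\in T_n} l\bigl(Y^{abc}(M')\bigr)=\sum_{(a,b,c)\in T_n} l\Bigl(\frac{1}{Y^{abc}(M)}\Bigr)=\sum_{(a,b,c)\in T_n} l\bigl(Y^{abc}(M'')\bigr).$$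
   Context: Dilogarithm: for $x\in(0,1)$ the Rogers dilogarithm is $L(x)=\mathrm{Li}_2(x)+\frac12\log x\,\log(1-x)$, and for $x>0$ one sets $l(x)=\frac{6}{\pi^2}L\bigl(\frac{x}{1+x}\bigr)$. Matrices: $B_n$ is the group of $n\times n$ real invertible upper triangular matrices and $N_n\subset B_n$ its unipotent subgroup (ones on the diagonal). $G\in B_n$ is totally positive if every minor of $G$ that does not vanish identically (as a function on $B_n$) is positive. $B_n^+\subset B_n$ and $N_n^+\subset N_n$ are the subsets of totally positive matrices. Maps $M\mapsto M'$, $M\mapsto M''$: let $P$ be the $n\times n$ matrix with $P_{ij}=\delta_{i+j,n+1}$. For every $M\in N_n^+$ there exist unique $M',M''\in N_n^+$ and a unique diagonal matrix $D_M$ such that $PMP=M'PD_MM''$; this defines $M'$ and $M''$. Flag minors: $[a,b]=\{i\in\mathbb N: a\le i\le b\}$ (empty if $a>b$). For $I,J\subset[1,n]$, $\Delta_I$ is the minor on the rows labeled by $I$ and the last $|I|$ columns; $\Delta^J$ is the minor on the first $|J|$ rows and the columns labeled by $J$; $\Delta_\emptyset=\Delta^\emptyset=1$. Y-variables, for $1\le a<b<c\le n$ (all minors are those of $M$): $$Y_{abc}(M)=\frac{\Delta_{[a,b-1]\cup[c+1,n]}\,\Delta_{[a+1,b]\cup[c,n]}}{\Delta_{[a,b]\cup[c+1,n]}\,\Delta_{[a+1,b-1]\cup[c,n]}},\qquad \tilde Y_{abc}(M)=\frac{\Delta_{[1,a]\cup[b+1,c-1]}\,\Delta_{[1,a-1]\cup[b,c]}}{\Delta_{[1,a]\cup[b,c-1]}\,\Delta_{[1,a-1]\cup[b+1,c]}},$$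 $$Y^{abc}(M)=\frac{\Delta^{[a,b]\cup[c+1,n]}\,\Delta^{[a+1,b-1]\cup[c,n]}}{\Delta^{[a,b-1]\cup[c+1,n]}\,\Delta^{[a+1,b]\cup[c,n]}},\qquad \tilde Y^{abc}(M)=\frac{\Delta^{[1,a]\cup[b,c-1]}\,\Delta^{[1,a-1]\cup[b+1,c]}}{\Delta^{[1,a]\cup[b+1,c-1]}\,\Delta^{[1,a-1]\cup[b,c]}}.$$ *)

(* Defs.v *)
From HB Require Import structures.
From mathcomp Require Import all_boot all_order all_algebra.
From mathcomp Require Import all_classical all_reals all_analysis.

Set Implicit Arguments.
Unset Strict Implicit.
Unset Printing Implicit Defensive.

Import Order.TTheory GRing.Theory Num.Theory.
Import numFieldNormedType.Exports.

Local Open Scope ring_scope.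

Definition dilog (R : realType) (x : R) : R :=
  limn (fun m => \sum_(1 <= k < m) x ^+ k / k%:R ^+ 2).

(* Meant for 0 < x < 1. *)
Definition rogersL (R : realType) (x : R) : R :=
  dilog x + 2^-1 * ln x * ln (1 - x).

(* Meant for 0 < x. *)
Definition rogersl (R : realType) (x : R) : R :=
  6 / pi ^+ 2 * rogersL (x / (1 + x)).

(* [is_trig_mx] means lower triangular, hence the transpose. *)
Definition in_B (R : realType) (n : nat) (G : 'M[R]_n) : Prop :=
  is_trig_mx G^T /\ G \in unitmx.

Definition in_N (R : realType) (n : nat) (G : 'M[R]_n) : Prop :=
  in_B G /\ forall i : 'I_n, G i i = 1.

(* A k x k minor is given by increasing maps f (rows) and g (columns). *)
Definition totally_positive (R : realType) (n : nat) (G : 'M[R]_n) : Prop :=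
  forall (k : nat) (f g : 'I_k -> 'I_n),
    {homo f : i j / (i < j)%N} -> {homo g : i j / (i < j)%N} ->
    (exists H : 'M[R]_n, in_B H /\ \det (mxsub f g H) != 0) ->
    0 < \det (mxsub f g G).

Definition in_Npos (R : realType) (n : nat) (G : 'M[R]_n) : Prop :=
  in_N G /\ totally_positive G.

Definition antidiag (R : realType) (n : nat) : 'M[R]_n :=
  \matrix_(i, j) (i.+1 + j.+1 == n.+1)%N%:R.

(* Mp and Mpp are the matrices M' and M'' attached to M in [in_Npos]. *)
Definition is_prime_pair (R : realType) (n : nat) (M Mp Mpp : 'M[R]_n) : Prop :=
  [/\ in_Npos Mp, in_Npos Mpp &
      exists D : 'M[R]_n, is_diag_mx D /\
        antidiag R n *m M *m antidiag R n = Mp *m antidiag R n *m D *m Mpp].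

(* The interval [a, b] of 1-based labels, as a set of 0-based indices. *)
Definition ivl (n a b : nat) : {set 'I_n} := [set i : 'I_n | (a <= i.+1 <= b)%N].

Lemma card_ord_set (n : nat) (I : {set 'I_n}) : (#|I| <= n)%N.
Proof. by rewrite -[leqRHS]card_ord max_card. Qed.

Definition first_ord (n : nat) (I : {set 'I_n}) (j : 'I_#|I|) : 'I_n :=
  widen_ord (card_ord_set I) j.

(* The value of [last_ord j] is n - #|I| + j. *)
Definition last_ord (n : nat) (I : {set 'I_n}) (j : 'I_#|I|) : 'I_n :=
  rev_ord (first_ord (rev_ord j)).

(* [enum_val] lists the elements of a subset of 'I_n in increasing order. *)
Definition row_flag_minor (R : realType) (n : nat) (M : 'M[R]_n)
    (I : {set 'I_n}) : R :=
  \det (mxsub (@enum_val _ (mem I)) (@last_ord n I) M).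

Definition col_flag_minor (R : realType) (n : nat) (M : 'M[R]_n)
    (J : {set 'I_n}) : R :=
  \det (mxsub (@first_ord n J) (@enum_val _ (mem J)) M).

(* "lo" and "up" stand for Y with lower and upper indices; a trailing "t"
   stands for the tilde. *)
Definition Ylo (R : realType) (n : nat) (M : 'M[R]_n) (a b c : nat) : R :=
  let D := row_flag_minor M in
  (D (ivl n a b.-1 :|: ivl n c.+1 n) * D (ivl n a.+1 b :|: ivl n c n))
  / (D (ivl n a b :|: ivl n c.+1 n) * D (ivl n a.+1 b.-1 :|: ivl n c n)).

Definition Ylot (R : realType) (n : nat) (M : 'M[R]_n) (a b c : nat) : R :=
  let D := row_flag_minor M in
  (D (ivl n 1 a :|: ivl n b.+1 c.-1) * D (ivl n 1 a.-1 :|: ivl n b c))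
  / (D (ivl n 1 a :|: ivl n b c.-1) * D (ivl n 1 a.-1 :|: ivl n b.+1 c)).

Definition Yup (R : realType) (n : nat) (M : 'M[R]_n) (a b c : nat) : R :=
  let D := col_flag_minor M in
  (D (ivl n a b :|: ivl n c.+1 n) * D (ivl n a.+1 b.-1 :|: ivl n c n))
  / (D (ivl n a b.-1 :|: ivl n c.+1 n) * D (ivl n a.+1 b :|: ivl n c n)).

Definition Yupt (R : realType) (n : nat) (M : 'M[R]_n) (a b c : nat) : R :=
  let D := col_flag_minor M in
  (D (ivl n 1 a :|: ivl n b c.-1) * D (ivl n 1 a.-1 :|: ivl n b.+1 c))
  / (D (ivl n 1 a :|: ivl n b.+1 c.-1) * D (ivl n 1 a.-1 :|: ivl n b c)).

(* Sum of F a b c over 1 <= a < b < c <= n. *)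
Definition sumT (R : realType) (n : nat) (F : nat -> nat -> nat -> R) : R :=
  \sum_(a < n.+1) \sum_(b < n.+1)
    \sum_(c < n.+1 | [&& 0 < a, a < b & b < c]%N) F a b c.

(* Main.v *)
Require Import Defs.
From HB Require Import structures.
From mathcomp Require Import all_boot all_order all_algebra.
From mathcomp Require Import all_classical all_reals all_analysis.
From mathcomp Require Import perm ring lra zify.

Import Order.TTheory GRing.Theory Num.Theory.
Import numFieldNormedType.Exports.

Local Open Scope ring_scope.

(* Fix S and write Y_{abc|S} = D(Sa) D(Sbc) / (D(Sab) D(Sc)), D being the row
   flag minors. The families [Ylo] and [Ylot] are Y_{abc|S} for two complementary
   choices of the context S. Toggling the membership of one element x in S for
   the triples of a quadruple p < q < r < s, in the lexicographic order of the
   quadruples, passes from one family to the other, and each step preserves the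
   sum of the l(Y): by the three-term Pluecker relations it is an identity in
   three variables, which is a difference of two five-term relations.
   Reflection of M in the antidiagonal turns this into the same statement for
   [Yup] and [Yupt]. For unipotent M the [Ylo] and the [Yupt] are the same ratios
   of solid minors, up to the order of the triples, so that the four sums
   agree. Finally the flag minors of M' and M'' are those of M on the reflected
   index sets, up to factors which cancel in Y; hence Y(M') is 1 / Y(M) for
   another of the four families, and similarly for M''. *)

(** * The Rogers dilogarithm *)

(** Comparison with the series of (i + 1) x^i, whose partial sums stay below (1 - x)^-2. The linear
    bound covers the coefficients 1/k and 1/k^2 together with their first two [pseries_diffs], as
    term-by-term differentiation requires. *)
Lemma is_cvg_pseries_linear {R : realType} (c : nat -> R) (x : R) :
  (forall i, 0 <= c i <= i.+1%:R) -> 0 <= x < 1 -> cvgn (pseries c x).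
Proof.
move=> hc /andP[x0 x1].
have c0 i : 0 <= c i by case/andP: (hc i).
have c1 i : c i <= i.+1%:R by case/andP: (hc i).
apply: (@series_le_cvg _ _ (fun i => i.+1%:R * x ^+ i)).
- by move=> i; rewrite mulr_ge0 ?exprn_ge0.
- by move=> i; rewrite mulr_ge0 ?exprn_ge0.
- by move=> i; rewrite ler_wpM2r ?exprn_ge0.
apply: nondecreasing_is_cvgn.
  apply/nondecreasing_seqP => i; rewrite /series /= big_nat_recr //=.
  by rewrite lerDl mulr_ge0 ?exprn_ge0.
have sumE i : (1 - x) ^+ 2 * \sum_(0 <= k < i) k.+1%:R * x ^+ k =
    1 - i.+1%:R * x ^+ i + i%:R * x ^+ i.+1.
  elim: i => [|i IH]; first by rewrite big_nil expr0; ring.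
  by rewrite big_nat_recr //= mulrDr IH !exprS -!natr1; ring.
exists ((1 - x) ^- 2) => _ [i _ <-]; rewrite /series /=.
have x1' : 0 < (1 - x) ^+ 2 by rewrite exprn_gt0 // subr_gt0.
rewrite -(ler_pM2l x1') sumE divff ?gt_eqF // -subr_ge0.
have -> : 1 - (1 - i.+1%:R * x ^+ i + i%:R * x ^+ i.+1) =
  x ^+ i * (1 + i%:R * (1 - x)) by rewrite exprS -natr1; ring.
by rewrite mulr_ge0 ?exprn_ge0 // addr_ge0 // mulr_ge0 // subr_ge0 ltW.
Qed.

Lemma eq_of_derive0 {R : realType} (f : R -> R) (a b : R) :
  (forall x, Order.min a b <= x <= Order.max a b -> is_derive x 1 f 0) ->
  f a = f b.
Proof.
wlog ab : a b / a <= b.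
  move=> H hf; case: (leP a b) => [/H|/ltW /H H']; first exact.
  by symmetry; apply: H' => x; rewrite minC maxC; apply: hf.
rewrite min_l // max_r // => hf.
rewrite -(subKr (f b) (f a)).
have [||_ _] := @MVT_segment _ f (fun=> 0) _ _ ab; last first.
- by rewrite mul0r => ->; rewrite subr0.
- apply: derivable_within_continuous => x; rewrite in_itv /= => /hf.
  by case.
- by move=> x /subset_itv_oo_cc; rewrite in_itv /= => /hf.
Qed.

Lemma is_derive_affine {R : realType} (a b t : R) :
  is_derive t 1 (fun x : R => a * x + b) a.
Proof.
have -> : (fun x : R => a * x + b) = (a \*: (@id R)) + cst b by [].
by apply: is_derive_eq; rewrite addr0 /GRing.scale /= mulr1.
Qed.

(** The coefficient at k = 0 is 0^-1 = 0, so the series is that of x^k / k over k >= 1. Its sum plus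
    ln (1 - x) vanishes at 0 and has derivative zero, the derived series being geometric. *)
Lemma lim_pseries_inv {R : realType} (x : R) : 0 <= x < 1 ->
  limn (pseries (fun k => k%:R^-1) x) = - ln (1 - x).
Proof.
move=> /andP[x0 x1]; apply/eqP; rewrite -subr_eq0 opprK; apply/eqP.
pose f (t : R) := limn (pseries (fun k => k%:R^-1) t) + ln (1 - t).
have f0 : f 0 = 0.
  rewrite /f subr0 ln1 addr0; apply: lim_near_cst => //.
  near=> m; rewrite /pseries /series /= big1 // => -[|i] _.
    by rewrite invr0 mul0r.
  by rewrite expr0n mulr0.
rewrite -f0 -/(f x); apply: eq_of_derive0 => t.
rewrite min_r // max_l // => /andP[t0 tx].
have t1 : t < 1 by apply: le_lt_trans x1.
(* A radius strictly between t and 1, at which the series and its derived series converge. *)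
have [s ts s1] : exists2 s : R, t < s & s < 1.
  by exists ((t + 1) / 2); lra.
have dE : pseries_diffs (fun k : nat => k%:R^-1) = (fun=> 1 : R).
  by apply/funext => i; rewrite /pseries_diffs mulfV.
have Dt : is_derive t 1 (fun x => limn (pseries (fun k : nat => k%:R^-1 : R) x))
    (1 - t)^-1.
  have -> : (1 - t)^-1 =
      limn (pseries (pseries_diffs (fun k : nat => k%:R^-1)) t).
    symmetry; apply/cvg_lim => //; rewrite dE /pseries.
    by rewrite -[(_ - _)^-1]mul1r; apply: cvg_geometric_series; rewrite ger0_norm.
  have s01 : 0 <= s < 1 by lra.
  apply: (@pseries_snd_diffs _ _ s).
  - apply: is_cvg_pseries_linear => // -[|i]; first by rewrite invr0 lexx ler01.
    rewrite invr_ge0 ler0n; apply: (@le_trans _ _ 1); last by rewrite ler1n.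
    by rewrite invf_le1 ?ltr0Sn // ler1n.
  - by rewrite dE; apply: is_cvg_pseries_linear => // i; rewrite ler01 ler1n.
  - rewrite dE; apply: is_cvg_pseries_linear => // i.
    by rewrite /pseries_diffs mulr1 ler0n lexx.
  - by rewrite !ger0_norm //; lra.
have Dl : is_derive t 1 (fun x : R => ln (1 - x)) ((1 - t)^-1 * (- 1)).
  apply: (@is_derive1_comp _ (@ln R) (fun x => 1 - x)).
    by apply: is_derive1_ln; rewrite subr_gt0.
  have -> : (fun x : R => 1 - x) = (fun x => - 1 * x + 1).
    by apply/funext => z; rewrite mulN1r addrC.
  exact: is_derive_affine.
by apply: is_derive_eq; rewrite mulrN1 subrr.
Unshelve. all: by end_near.
Qed.

(** Term-by-term differentiation: x times the derived series is the series of [lim_pseries_inv]. *)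
Lemma is_derive_dilog {R : realType} (x : R) : 0 < x < 1 ->
  is_derive x 1 (@dilog R) (- ln (1 - x) / x).
Proof.
move=> /andP[x0 x1]; pose c (k : nat) : R := k%:R ^- 2.
have -> : @dilog R = fun t => limn (pseries c t).
  apply/funext => t; rewrite /dilog /pseries /series /=.
  congr (limn _); apply/funext => -[|m]; first by rewrite !big_geq.
  rewrite [RHS]big_ltn // /c expr0n /= invr0 mul0r add0r.
  by apply: eq_bigr => i _; rewrite mulrC.
have [s xs s1] : exists2 s : R, x < s & s < 1 by exists ((x + 1) / 2); lra.
have s01 : 0 <= s < 1 by lra.
have dE i : pseries_diffs c i = i.+1%:R^-1.
  by rewrite /pseries_diffs /c expr2 invfM mulVKf ?pnatr_eq0.
have inv1 i : 0 <= (i.+1%:R^-1 : R) <= 1.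
  by apply/andP; split; [rewrite invr_ge0|rewrite invf_le1 ?ltr0Sn // ler1n].
apply: is_derive_eq.
  apply: (@pseries_snd_diffs _ c s).
  - apply: is_cvg_pseries_linear => // -[|i]; rewrite /c.
      by rewrite expr0n invr0 lexx ler01.
    rewrite -exprVn exprn_ge0 ?invr_ge0 //=; case/andP: (inv1 i) => i0 i1.
    apply: (@le_trans _ _ 1); last by rewrite ler1n.
    by rewrite exprn_ile1.
  - apply: is_cvg_pseries_linear => // i; rewrite dE; case/andP: (inv1 i) => -> i1 /=.
    by apply: (le_trans i1); rewrite ler1n.
  - apply: is_cvg_pseries_linear => // i; rewrite /pseries_diffs -/(pseries_diffs c i.+1) dE.
    case/andP: (inv1 i.+1) => i0 i1.
    by rewrite mulr_ge0 //= ler_piMr.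
  - by rewrite !ger0_norm //; lra.
rewrite -lim_pseries_inv ?ltW //.
apply: (mulIf (lt0r_neq0 x0)); rewrite divfK ?gt_eqF //.
have cvgd : cvgn (pseries (pseries_diffs c) x).
  apply: is_cvg_pseries_linear; last by rewrite x1 ltW.
  move=> i; rewrite dE; case/andP: (inv1 i) => -> i1 /=.
  by apply: (le_trans i1); rewrite ler1n.
(* The limit is taken along shifted partial sums: the term of index 0 is 0, and the others are x
   times those of the derived series. *)
apply/esym/cvg_lim => //; rewrite mulrC -cvg_shiftS.
have -> : (fun m => pseries (fun k => k%:R^-1) x m.+1) =
    (fun m => x * pseries (pseries_diffs c) x m).
  apply/funext => m; rewrite /pseries /series /= big_nat_recl // invr0 mul0r add0r.
  by rewrite mulr_sumr; apply: eq_bigr => i _; rewrite dE exprS mulrCA.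
by apply: cvgM => //; exact: cvg_cst.
Qed.

Lemma is_derive_rogersL {R : realType} (x : R) : 0 < x < 1 ->
  is_derive x 1 (@rogersL R) (- 2^-1 * (ln (1 - x) / x + ln x / (1 - x))).
Proof.
move=> x01; have /andP[x0 x1] := x01.
have Dl : is_derive x 1 (fun x : R => ln (1 - x)) ((1 - x)^-1 * (- 1)).
  apply: (@is_derive1_comp _ (@ln R) (fun x => 1 - x)).
    by apply: is_derive1_ln; rewrite subr_gt0.
  have -> : (fun x : R => 1 - x) = (fun x => - 1 * x + 1).
    by apply/funext => z; rewrite mulN1r addrC.
  exact: is_derive_affine.
have D0 := is_derive1_ln x0.
have D1 := is_derive_dilog _ x01.
have -> : @rogersL R = @dilog R + cst 2^-1 * @ln R * (fun x => ln (1 - x)) by [].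
apply: is_derive_eq.
rewrite /GRing.scale /= ?fctE /=.
by field; lra.
Qed.

(* The differences of logarithms are [ln (1 + g)] and [ln g] for
   [g = (a * t + b) / (c * t + d)]. *)
Lemma is_derive_rogersl_mobius {R : realType} (a b c d t : R) :
  0 < a * t + b -> 0 < c * t + d ->
  is_derive t 1 (fun x => rogersl ((a * x + b) / (c * x + d)))
   (6 / pi ^+ 2 * 2^-1 * (a * d - b * c) / (c * t + d) *
     ((ln (a * t + b + (c * t + d)) - ln (c * t + d)) / (a * t + b) -
      (ln (a * t + b) - ln (c * t + d)) / (a * t + b + (c * t + d)))).
Proof.
move=> N0 Q0.
have NQ0 := addr_gt0 N0 Q0.
pose N x := a * x + b; pose NQ x := (a + c) * x + (b + d).
have NQE : N t + (c * t + d) = NQ t by rewrite /N /NQ; ring.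
have DN : is_derive t 1 N a by exact: is_derive_affine.
have DNQ : is_derive t 1 NQ (a + c) by exact: is_derive_affine.
rewrite -/(N t) NQE in N0 NQ0 *.
have DV := is_deriveV (lt0r_neq0 NQ0) DNQ.
have Dg : is_derive t 1 (N * (fun x => (NQ x)^-1))
   (N t *: (- NQ t ^- 2 *: (a + c)) + (NQ t)^-1 *: a) by exact: is_deriveM.
have g01 : 0 < (N * (fun x => (NQ x)^-1)) t < 1.
  rewrite /= divr_gt0 // ltr_pdivrMr // mul1r -NQE; lra.
have DL := is_derive1_comp (is_derive_rogersL _ g01) Dg.
have DQ : is_derive t 1 (fun x => c * x + d) c by exact: is_derive_affine.
have Q0' : \forall x \near t, 0 < c * x + d.
  have ct : {for t, continuous (fun x => c * x + d)}.
    by apply/differentiable_continuous/derivable1_diffP; case: DQ.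
  exact: (cvgr_gt _ ct).
have NQ0' : \forall x \near t, 0 < NQ x.
  have ct : {for t, continuous NQ}.
    by apply/differentiable_continuous/derivable1_diffP; case: DNQ.
  exact: (cvgr_gt _ ct).
(* [NQ] is numerator plus denominator, so g / (1 + g) = N / NQ. This is used where c x + d and [NQ]
   are positive, which is a neighbourhood of t. *)
apply: (@near_eq_is_derive _ _ _
    (cst (6 / pi ^+ 2) * (@rogersL R \o (N * (fun x => (NQ x)^-1))))).
  near=> x; rewrite /rogersl /GRing.scale /=; congr (_ * rogersL _).
  have h1 : 0 < c * x + d by near: x.
  have h2 : 0 < NQ x by near: x.
  rewrite -[RHS]/(N x / (c * x + d) / (1 + N x / (c * x + d))).
  have -> : 1 + N x / (c * x + d) = NQ x / (c * x + d).
    by rewrite /N /NQ; field; rewrite gt_eqF.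
  by rewrite invf_div mulrA divfK ?gt_eqF.
apply: is_derive_eq; rewrite /GRing.scale /= ?fctE /=.
have -> : 1 - N t / NQ t = (c * t + d) / NQ t.
  by rewrite -NQE; field; rewrite NQE gt_eqF.
rewrite !ln_div ?posrE //.
have -> : a * d - b * c = a * (c * t + d) - c * N t by rewrite /N; ring.
rewrite -NQE.
set k := 6 / pi ^+ 2.
by field; rewrite NQE !gt_eqF.
Unshelve. all: by end_near.
Qed.

(** Along x the two derivatives cancel. Both arguments are written as Moebius functions so that
    [is_derive_rogersl_mobius] applies. *)
Lemma rogersl_inv {R : realType} : exists C : R,
  forall x : R, 0 < x -> rogersl x + rogersl (1 / x) = C.
Proof.
pose f (t : R) := rogersl ((1 * t + 0) / (0 * t + 1)) +
                  rogersl ((0 * t + 1) / (1 * t + 0)).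
exists (f 1) => x x0.
have -> : rogersl x + rogersl (1 / x) = f x.
  by rewrite /f !mul1r !mul0r !addr0 !add0r ?divr1 ?mul1r.
apply: eq_of_derive0 => t /andP[t1 _].
have t0 : 0 < t by apply: lt_le_trans t1; rewrite lt_min x0 ltr01.
have e1 : 0 < 1 * t + 0 by rewrite mul1r addr0.
have e2 : 0 < 0 * t + 1 by rewrite mul0r add0r.
have D1 := is_derive_rogersl_mobius _ _ _ _ _ e1 e2.
have D2 := is_derive_rogersl_mobius _ _ _ _ _ e2 e1.
apply: (is_derive_eq (is_deriveD D1 D2)).
rewrite !mul1r !mul0r !addr0 !add0r ln1 [1 + t]addrC.
by set k := 6 / pi ^+ 2; field; lra.
Qed.

(* The defect is 0, but its constancy suffices and avoids the limits at 0. *)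
Definition pentagon_defect {R : realType} (x y : R) : R :=
  rogersl x + rogersl (y * (1 + x)) - rogersl y - rogersl (x * y / (1 + y))
  - rogersl (x / (1 + y + x * y)).

(** In each variable separately the five arguments are constants or Moebius functions. First x moves
    with y fixed, then y; once the logarithms of products are expanded, either derivative is
    zero. *)
Lemma pentagon_defect_cst {R : realType} (x y x' y' : R) :
  0 < x -> 0 < y -> 0 < x' -> 0 < y' ->
  pentagon_defect x y = pentagon_defect x' y'.
Proof.
move=> x0 y0 x0' y0'; transitivity (pentagon_defect x' y).
  pose f t := rogersl ((1 * t + 0) / (0 * t + 1))
    + rogersl ((y * t + y) / (0 * t + 1)) - rogersl y
    - rogersl ((y * t + 0) / (0 * t + (1 + y)))
    - rogersl ((1 * t + 0) / (y * t + (1 + y))).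
  have fE z : pentagon_defect z y = f z.
    rewrite /f /pentagon_defect !mul1r !mul0r !addr0 !add0r invr1 !mulr1.
    congr (_ + rogersl _ - _ - rogersl (_ / _) - rogersl (_ / _)); ring.
  rewrite !fE; apply: eq_of_derive0 => t /andP[t1 _].
  have t0 : 0 < t by apply: lt_le_trans t1; rewrite lt_min x0 x0'.
  have yt0 : 0 < y * t by exact: mulr_gt0.
  have e1 : 0 < 1 * t + 0 by lra.
  have e2 : 0 < 0 * t + 1 by lra.
  have e3 : 0 < y * t + y by lra.
  have e4 : 0 < y * t + 0 by lra.
  have e5 : 0 < 0 * t + (1 + y) by lra.
  have e6 : 0 < y * t + (1 + y) by lra.
  have D1 := is_derive_rogersl_mobius _ _ _ _ _ e1 e2.
  have D2 := is_derive_rogersl_mobius _ _ _ _ _ e3 e2.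
  have D3 := is_derive_rogersl_mobius _ _ _ _ _ e4 e5.
  have D4 := is_derive_rogersl_mobius _ _ _ _ _ e1 e6.
  apply: (is_derive_eq (is_deriveB (is_deriveB (is_deriveB
    (is_deriveD D1 D2) (is_derive_cst (rogersl y) t 1)) D3) D4)).
  rewrite !mul1r !mul0r !addr0 !add0r ln1.
  have -> : y * t + y + 1 = y * t + (1 + y) by ring.
  have -> : t + (y * t + (1 + y)) = (1 + t) * (1 + y) by ring.
  have -> : y * t + y = y * (1 + t) by ring.
  have -> : t + 1 = 1 + t by ring.
  rewrite !lnM ?posrE; try lra.
  by set k := 6 / pi ^+ 2; field; lra.
pose f t := rogersl x' + rogersl (((1 + x') * t + 0) / (0 * t + 1))
    - rogersl ((1 * t + 0) / (0 * t + 1))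
    - rogersl ((x' * t + 0) / (1 * t + 1))
    - rogersl ((0 * t + x') / ((1 + x') * t + 1)).
have fE z : pentagon_defect x' z = f z.
  rewrite /f /pentagon_defect !mul1r !mul0r !addr0 !add0r invr1 !mulr1.
  congr (_ + rogersl _ - _ - rogersl (_ / _) - rogersl (_ / _)); ring.
rewrite !fE; apply: eq_of_derive0 => t /andP[t1 _].
have t0 : 0 < t by apply: lt_le_trans t1; rewrite lt_min y0 y0'.
have xt0 : 0 < x' * t by exact: mulr_gt0.
have e1 : 0 < 1 * t + 0 by lra.
have e2 : 0 < 0 * t + 1 by lra.
have e3 : 0 < (1 + x') * t + 0 by lra.
have e4 : 0 < x' * t + 0 by lra.
have e5 : 0 < 1 * t + 1 by lra.
have e6 : 0 < 0 * t + x' by lra.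
have e7 : 0 < (1 + x') * t + 1 by lra.
have D1 := is_derive_rogersl_mobius _ _ _ _ _ e3 e2.
have D2 := is_derive_rogersl_mobius _ _ _ _ _ e1 e2.
have D3 := is_derive_rogersl_mobius _ _ _ _ _ e4 e5.
have D4 := is_derive_rogersl_mobius _ _ _ _ _ e6 e7.
apply: (is_derive_eq (is_deriveB (is_deriveB (is_deriveB
    (is_deriveD (is_derive_cst (rogersl x') t 1) D1) D2) D3) D4)).
rewrite !mul1r !mul0r !addr0 !add0r ln1.
have -> : x' * t + (t + 1) = (1 + x') * t + 1 by ring.
have -> : x' + ((1 + x') * t + 1) = (1 + x') * (t + 1) by ring.
rewrite !lnM ?posrE; try lra.
by set k := 6 / pi ^+ 2; field; lra.
Qed.

(* Two pentagons sharing the argument [u / (1 + v + u * v)]; it cancels. *)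
Lemma rogersl_octagon {R : realType} (u v w : R) : 0 < u -> 0 < v -> 0 < w ->
  rogersl u + rogersl (u * w / (1 + u)) + rogersl (v * (1 + u))
    + rogersl (w * (1 + v + u * v) / (1 + u + u * w)) =
  rogersl v + rogersl (w * (1 + v)) + rogersl (u * v / (1 + v))
    + rogersl (u * (1 + w + v * w) / (1 + v + u * v)).
Proof.
move=> u0 v0 w0.
have uv0 := mulr_gt0 u0 v0; have vw0 := mulr_gt0 v0 w0; have uw0 := mulr_gt0 u0 w0.
have uvw0 := mulr_gt0 uv0 w0; have vv0 := mulr_gt0 v0 v0.
have vvw0 := mulr_gt0 vv0 w0; have uvv0 := mulr_gt0 u0 vv0; have uvvw0 := mulr_gt0 u0 vvw0.
(* The second pentagon is taken at (q, p): [p] is the last argument of the first one, and 1 + p = (1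
   + u) (1 + v) / (1 + v + u v) simplifies the others. *)
pose p := u / (1 + v + u * v); pose q := w * (1 + v).
have p0 : 0 < p by rewrite divr_gt0 //; lra.
have q0 : 0 < q by rewrite mulr_gt0 //; lra.
have := pentagon_defect_cst _ _ _ _ u0 v0 q0 p0.
rewrite /pentagon_defect.
have -> : p * (1 + q) = u * (1 + w + v * w) / (1 + v + u * v).
  by rewrite /p /q; field; lra.
have -> : q * p / (1 + p) = u * w / (1 + u).
  by rewrite /p /q; field; do ?(apply/andP; split); nra.
have -> : q / (1 + p + q * p) = w * (1 + v + u * v) / (1 + u + u * w).
  by rewrite /p /q; field; do ?(apply/andP; split); nra.
rewrite -/p -/q; lra.
Qed.

(** * Determinants of flag minors *)

(** Indexing by naturals lets sizes and indices be rewritten without casts between ordinal types. *)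
Definition mdet {R : comNzRingType} (k : nat) (F : nat -> nat -> R) : R :=
  \det (\matrix_(i < k, j < k) F i j).

Lemma eq_mdet {R : comNzRingType} (k : nat) (F G : nat -> nat -> R) :
  (forall i j, (i < k)%N -> (j < k)%N -> F i j = G i j) -> mdet k F = mdet k G.
Proof. by move=> FG; congr (\det _); apply/matrixP => i j; rewrite !mxE FG. Qed.

Lemma mdet_tr {R : comNzRingType} (k : nat) (F : nat -> nat -> R) :
  mdet k (fun i j => F j i) = mdet k F.
Proof. by rewrite /mdet -det_tr; congr (\det _); apply/matrixP => i j; rewrite !mxE. Qed.

(** Rows and columns undergo the same permutation, so its sign appears twice. *)
Lemma mdet_rev {R : comNzRingType} (k : nat) (F : nat -> nat -> R) :
  mdet k (fun i j => F (k - i.+1)%N (k - j.+1)%N) = mdet k F.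
Proof.
pose s : 'S_k := perm (@rev_ord_inj k); pose A := \matrix_(i < k, j < k) F i j.
have -> : mdet k (fun i j => F (k - i.+1)%N (k - j.+1)%N) =
    \det (col_perm s (row_perm s A)).
  by congr (\det _); apply/matrixP => i j; rewrite !mxE !permE.
rewrite -[s]invgK col_permE invgK row_permE !det_mulmx !det_perm.
by rewrite odd_permV mulrAC -expr2 sqrr_sign mul1r.
Qed.

(** Row p moves to the top: the Laplace expansions along that row have the same minors and differ by
    a sign. *)
Lemma mdet_expand0 {R : comNzRingType} (k : nat) (F : nat -> nat -> R) (p : nat) :
  (p <= k)%N ->
  mdet k.+1 F = (-1) ^+ p * mdet k.+1
    (fun i j => if i is i'.+1 then F (bump p i') j else F p j).
Proof.
move=> pk; pose p' : 'I_k.+1 := inord p.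
have p'E : p' = p :> nat by rewrite inordK.
rewrite /mdet (expand_det_row _ p') (expand_det_row _ ord0) mulr_sumr.
apply: eq_bigr => j _; rewrite !mxE /cofactor p'E /= add0n exprD.
rewrite -mulrA mulrCA; congr (_ * (_ * (_ * _))).
by congr (\det _); apply/matrixP => x y; rewrite !mxE /= p'E.
Qed.

(** The block matrix is a block upper unipotent factor times a block lower triangular one, whose
    upper left block is the Schur complement of [A]. *)
Lemma mdet_schur {R : fieldType} (p k : nat) (F : nat -> nat -> R)
    (A := \matrix_(i < k, j < k) F (p + i)%N (p + j)%N) :
  A \in unitmx ->
  mdet (p + k) F = \det A * mdet p (fun i j => F i j -
    \sum_(s < k) \sum_(t < k) F i (p + s)%N * invmx A s t * F (p + t)%N j).
Proof.
move=> uA.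
pose A1 := \matrix_(i < p, j < p) F i j.
pose A2 := \matrix_(i < p, j < k) F i (p + j)%N.
pose A3 := \matrix_(i < k, j < p) F (p + i)%N j.
have -> : mdet (p + k) F = \det (block_mx A1 A2 A3 A).
  congr (\det _); apply/matrixP => i j; rewrite mxE.
  by case: (split_ordP i) => i' ->; case: (split_ordP j) => j' ->;
    rewrite ?block_mxEul ?block_mxEur ?block_mxEdl ?block_mxEdr mxE.
have -> : block_mx A1 A2 A3 A =
    block_mx 1%:M (A2 *m invmx A) 0 1%:M *m
    block_mx (A1 - A2 *m invmx A *m A3) 0 A3 A.
  rewrite mulmx_block !mul1mx !mul0mx !add0r mulmxKV // subrK.
  by [].
rewrite det_mulmx det_ublock !det1 !mul1r det_lblock mulrC; congr (_ * _).
congr (\det _); apply/matrixP => i j; rewrite !mxE; congr (_ - _).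
rewrite exchange_big; apply: eq_bigr => t _; rewrite !mxE mulr_suml.
by apply: eq_bigr => s _; rewrite !mxE.
Qed.

Lemma mdet_ublock {R : comNzRingType} (p k : nat) (F : nat -> nat -> R) :
  (forall i j, (i < k)%N -> (j < p)%N -> F (p + i)%N j = 0) ->
  mdet (p + k) F = mdet p F * mdet k (fun i j => F (p + i)%N (p + j)%N).
Proof.
move=> F0; rewrite /mdet -(det_ublock _ (\matrix_(i < p, j < k) F i (p + j)%N)).
congr (\det _); apply/matrixP => i j; rewrite mxE.
by case: (split_ordP i) => i' ->; case: (split_ordP j) => j' ->;
  rewrite ?block_mxEul ?block_mxEur ?block_mxEdl ?block_mxEdr mxE //= F0.
Qed.

Lemma mdet_unitriangular {R : comNzRingType} (k : nat) (F : nat -> nat -> R) :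
  (forall i j, (j < i < k)%N -> F i j = 0) ->
  (forall i, (i < k)%N -> F i i = 1) -> mdet k F = 1.
Proof.
move=> F0 F1; rewrite -mdet_tr /mdet det_trig.
  by rewrite big1 // => i _; rewrite mxE F1.
by apply/is_trig_mxP => i j ij; rewrite mxE F0 // ij /=.
Qed.

(** * Flag minors through lists of rows or columns *)

Definition ent {R : comNzRingType} {n : nat} (M : 'M[R]_n) (i j : nat) : R :=
  if insub i is Some i' then (if insub j is Some j' then M i' j' else 0) else 0.

Lemma entE {R : comNzRingType} {n : nat} (M : 'M[R]_n) (i j : 'I_n) :
  ent M i j = M i j.
Proof. by rewrite /ent !valK. Qed.

Definition vals {n : nat} (I : {set 'I_n}) : seq nat := [seq val i | i <- enum I].

Lemma size_vals {n : nat} (I : {set 'I_n}) : size (vals I) = #|I|.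
Proof. by rewrite size_map -cardE. Qed.

Lemma mem_vals {n : nat} (I : {set 'I_n}) (i : 'I_n) :
  (val i \in vals I) = (i \in I).
Proof. by rewrite (mem_map val_inj) mem_enum. Qed.

Lemma vals_lt {n : nat} (I : {set 'I_n}) (x : nat) : x \in vals I -> (x < n)%N.
Proof. by case/mapP => i _ ->; exact: ltn_ord. Qed.

Lemma vals_sorted {n : nat} (I : {set 'I_n}) : sorted ltn (vals I).
Proof.
apply: (subseq_sorted ltn_trans _ (iota_ltn_sorted 0 n)).
by rewrite -val_enum_ord; apply: map_subseq; rewrite enumT; exact: filter_subseq.
Qed.

(** A strictly increasing list is determined by its members, so [vals I] can be computed by
    exhibiting a candidate. *)
Lemma valsE {n : nat} (I : {set 'I_n}) (s : seq nat) :
  sorted ltn s -> (forall x, x \in s -> (x < n)%N) ->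
  (forall i : 'I_n, (val i \in s) = (i \in I)) -> vals I = s.
Proof.
move=> ss sn sI; apply: (irr_sorted_eq ltn_trans ltnn) => //.
  exact: vals_sorted.
move=> x; apply/idP/idP => [/[dup] /vals_lt xn|/[dup] /sn xn].
  by rewrite -[x]/(val (Ordinal xn)) mem_vals sI.
by rewrite -[x]/(val (Ordinal xn)) mem_vals sI.
Qed.

Lemma nth_vals {n : nat} (I : {set 'I_n}) (i : 'I_#|I|) :
  nth 0%N (vals I) i = enum_val i.
Proof.
have iI : (i < size (enum I))%N by rewrite -cardE.
by rewrite (nth_map (enum_val i)) // -enum_val_nth.
Qed.

(** Lists in any order are allowed, so that a row can be brought to the front at the cost of a
    sign. *)
Definition flagdet {R : comNzRingType} {n : nat} (M : 'M[R]_n) (s : seq nat) : R :=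
  mdet (size s) (fun i j => ent M (nth 0%N s i) (n - size s + j)%N).

Definition coflagdet {R : comNzRingType} {n : nat} (M : 'M[R]_n) (s : seq nat) : R :=
  mdet (size s) (fun i j => ent M i (nth 0%N s j)).

Lemma val_last_ord {n : nat} (I : {set 'I_n}) (j : 'I_#|I|) :
  last_ord j = (n - #|I| + j)%N :> nat.
Proof.
have E k l : (k <= n)%N -> (l < k)%N -> (n - (k - l.+1).+1 = n - k + l)%N by lia.
exact: E (card_ord_set I) (ltn_ord j).
Qed.

Lemma row_flag_minorE {R : realType} {n : nat} (M : 'M[R]_n) (I : {set 'I_n}) :
  row_flag_minor M I = flagdet M (vals I).
Proof.
rewrite /flagdet size_vals; congr (\det _); apply/matrixP => i j.
by rewrite !mxE nth_vals -val_last_ord entE.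
Qed.

Lemma col_flag_minorE {R : realType} {n : nat} (M : 'M[R]_n) (I : {set 'I_n}) :
  col_flag_minor M I = coflagdet M (vals I).
Proof.
rewrite /coflagdet size_vals; congr (\det _); apply/matrixP => i j.
by rewrite !mxE nth_vals -(entE M (first_ord i)).
Qed.

(** * Positivity of the flag minors *)

Lemma enum_val_homo {n : nat} (I : {set 'I_n}) :
  {homo @enum_val _ (mem I) : i j / (i < j)%N}.
Proof.
move=> i j ij; rewrite -!nth_vals.
by apply: (sorted_ltn_nth ltn_trans) ij => //;
  rewrite ?vals_sorted // inE size_vals ltn_ord.
Qed.

Lemma last_ord_homo {n : nat} (I : {set 'I_n}) :
  {homo @last_ord n I : i j / (i < j)%N}.
Proof. by move=> i j ij; rewrite !val_last_ord ltn_add2l. Qed.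

Lemma homo_ord_ge {n k : nat} (f : 'I_k -> 'I_n) :
  {homo f : i j / (i < j)%N} -> forall i : 'I_k, (i <= f i)%N.
Proof.
move=> fh [i ik] /=; elim: i ik => [//|i IH] ik.
have ik' : (i < k)%N by exact: ltnW.
by apply: leq_ltn_trans (IH ik') _; apply: fh => /=.
Qed.

Lemma homo_ord_le {n k : nat} (f : 'I_k -> 'I_n) :
  {homo f : i j / (i < j)%N} -> forall i : 'I_k, (f i + k <= n + i)%N.
Proof.
move=> fh i.
have gh : {homo (fun i => rev_ord (f (rev_ord i))) : i j / (i < j)%N}.
  move=> x y xy; have : (f (rev_ord y) < f (rev_ord x))%N.
    by apply: fh => /=; have := ltn_ord y; lia.
  by rewrite /=; have := ltn_ord (f (rev_ord x)); lia.
have := homo_ord_ge _ gh (rev_ord i); rewrite rev_ordK /=.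
by have := ltn_ord i; have := ltn_ord (f i); lia.
Qed.

(* The witness [H] is unipotent and its submatrix is lower triangular. *)
Lemma totally_positive_minor {R : realType} {n k : nat} (M : 'M[R]_n)
    (f g : 'I_k -> 'I_n) :
  totally_positive M -> {homo f : i j / (i < j)%N} ->
  {homo g : i j / (i < j)%N} -> (forall i, f i <= g i)%N ->
  0 < \det (mxsub f g M).
Proof.
move=> Mp fh gh fg; apply: Mp => //.
have mono (h : 'I_k -> 'I_n) : {homo h : i j / (i < j)%N} ->
    forall i j, (h i <= h j)%N -> (i <= j)%N.
  by move=> hh i j; apply: contraTT; rewrite -!ltnNge; exact: hh.
(* Ones on the diagonal and at the positions (f i, g i), which lie on or above it. *)
pose H : 'M[R]_n := \matrix_(x, y)
  ((x == y) || [exists i, (x == f i) && (y == g i)])%:R.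
have Hxx x : H x x = 1 by rewrite mxE eqxx.
have Hup (x y : 'I_n) : (y < x)%N -> H x y = 0.
  move=> yx; rewrite mxE; case: eqP => [xy|_]; first by rewrite xy ltnn in yx.
  case: existsP => // -[i /andP[/eqP xE /eqP yE]].
  by have := fg i; rewrite -xE -yE leqNgt yx.
have Htr : is_trig_mx H^T by apply/is_trig_mxP => i j ij; rewrite mxE Hup.
exists H; split; first split => //.
  rewrite unitmxE -det_tr det_trig // big1 ?unitr1 // => i _.
  by rewrite mxE Hxx.
rewrite det_trig.
  rewrite big1 ?oner_eq0 // => i _; rewrite !mxE.
  by case: existsP => [_|[]]; [rewrite orbT|exists i; rewrite !eqxx].
(* A nonzero entry (i, j) of the submatrix either comes from the diagonal of [H], and then g j = f i
   <= g i, or from a position (f l, g l), and then i = l = j. *)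
apply/is_trig_mxP => i j ij; rewrite !mxE.
case: eqP => [fgE|_] /=.
  suff: (j <= i)%N by rewrite leqNgt ij.
  by apply: (mono g) => //; rewrite -fgE.
case: existsP => // -[l /andP[/eqP fE /eqP gE]].
have il : (i <= l)%N by apply: (mono f) => //; rewrite fE.
have li : (l <= i)%N by apply: (mono f) => //; rewrite fE.
have jl : (j <= l)%N by apply: (mono g) => //; rewrite gE.
by have := leq_trans jl li; rewrite leqNgt ij.
Qed.

Lemma row_flag_minor_gt0 {R : realType} {n : nat} (M : 'M[R]_n) (I : {set 'I_n}) :
  totally_positive M -> 0 < row_flag_minor M I.
Proof.
move=> Mp; apply: totally_positive_minor => //.
- exact: enum_val_homo.
- exact: last_ord_homo.
move=> i; rewrite val_last_ord.
have E a k l : (k <= n)%N -> (a + k <= n + l)%N -> (a <= n - k + l)%N by lia.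
exact: E (card_ord_set I) (homo_ord_le _ (enum_val_homo I) i).
Qed.

Lemma col_flag_minor_gt0 {R : realType} {n : nat} (M : 'M[R]_n) (I : {set 'I_n}) :
  totally_positive M -> 0 < col_flag_minor M I.
Proof.
move=> Mp; apply: totally_positive_minor => //.
  exact: enum_val_homo.
by move=> i; have := homo_ord_ge _ (enum_val_homo I) i.
Qed.

(** * Three-term Pluecker relations *)

Lemma flagdet_move {R : comNzRingType} {n : nat} (M : 'M[R]_n) (s1 s2 : seq nat)
    (x : nat) :
  flagdet M (s1 ++ x :: s2) = (-1) ^+ size s1 * flagdet M (x :: s1 ++ s2).
Proof.
have sE : size (s1 ++ x :: s2) = (size (s1 ++ s2)).+1.
  by rewrite !size_cat addnS.
rewrite /flagdet sE (@mdet_expand0 _ _ _ (size s1)); last first.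
  by rewrite size_cat leq_addr.
congr (_ * _); apply: eq_mdet => -[|i] j _ _ /=.
  by rewrite nth_cat ltnn subnn.
congr ent; rewrite !nth_cat /bump; case: (leqP (size s1) i) => h /=.
  rewrite ifF; last by lia.
  by rewrite (_ : 1 + i - size s1 = (i - size s1).+1)%N //; lia.
by rewrite add0n h.
Qed.

Lemma vals_setU1 {n : nat} (T : {set 'I_n}) (x : 'I_n) : x \notin T ->
  exists p1 p2, [/\ vals (x |: T) = p1 ++ val x :: p2, vals T = p1 ++ p2 &
    size p1 = count (fun y => y < x)%N (vals T)].
Proof.
move=> xT; have : val x \in vals (x |: T) by rewrite mem_vals setU11.
case/splitPr vE : {1}_ / => [p1 p2].
have := vals_sorted (x |: T); rewrite vE => vs.
have vT : vals T = p1 ++ p2.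
  apply: valsE.
  - apply: subseq_sorted vs; first exact: ltn_trans.
    by rewrite cat_subseq // subseq_cons.
  - by move=> y yp; apply: (@vals_lt _ (x |: T)); rewrite vE mem_cat inE orbCA -mem_cat yp orbT.
  move=> i; have := mem_vals (x |: T) i; rewrite vE mem_cat !inE.
  have := vs; rewrite sorted_pairwise; last exact: ltn_trans.
  move/(pairwise_uniq ltnn).
  rewrite -cat1s uniq_catCA cat1s cons_uniq => /andP[xp _].
  rewrite orbCA -mem_cat; case: (eqVneq i x) => [->|ix].
    by rewrite eqxx /= (negbTE xT) (negbTE xp).
  by rewrite (inj_eq val_inj) (negbTE ix).
exists p1, p2; split => //.
move: vs; rewrite (sorted_pairwise ltn_trans) pairwise_cat allrel_consr.
case/and3P => /andP[p1x _] _ /= /andP[p2x _].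
rewrite vT count_cat -[LHS]addn0; congr (_ + _)%N.
  by apply/esym/eqP; rewrite -all_count; apply: sub_all p1x.
apply/esym/eqP; rewrite -leqn0 leqNgt -has_count -all_predC.
by apply: sub_all p2x => y /= xy; rewrite -leqNgt ltnW.
Qed.

(** The sign of moving x from its sorted place in [x |: T] to the front. *)
Definition pos_sign {R : comNzRingType} {n : nat} (x : 'I_n) (T : {set 'I_n}) : R :=
  (-1) ^+ count (fun y => y < x)%N (vals T).

Lemma flagdet_setU1 {R : comNzRingType} {n : nat} (M : 'M[R]_n)
    (T : {set 'I_n}) (x : 'I_n) : x \notin T ->
  flagdet M (vals (x |: T)) = pos_sign x T * flagdet M (val x :: vals T).
Proof.
move=> /vals_setU1[p1 [p2 [-> vT szE]]].
by rewrite /pos_sign -szE vT flagdet_move.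
Qed.

(** As x < y, adjoining y leaves the position of x unchanged, so both signs refer to T alone. All
    terms of a three-term relation then carry the same product of three signs. *)
Lemma flagdet_setU2 {R : comNzRingType} {n : nat} (M : 'M[R]_n)
    (T : {set 'I_n}) (x y : 'I_n) : (x < y)%N -> x \notin T -> y \notin T ->
  flagdet M (vals (x |: (y |: T))) =
  pos_sign x T * pos_sign y T * flagdet M [:: val x, val y & vals T].
Proof.
move=> xy xT yT; rewrite flagdet_setU1; last first.
  by rewrite !inE negb_or xT andbT; apply: contraTneq xy => ->; rewrite ltnn.
have [p1 [p2 [vE vT szE]]] := vals_setU1 _ _ yT.
rewrite -mulrA; congr (_ * _).
  rewrite /pos_sign vE vT !count_cat /= ltnNge (ltnW xy).
  by [].
(* On its way to the front y also passes x; exchanging the two again cancels this extra sign. *)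
rewrite vE -cat_cons flagdet_move /= -vT /pos_sign -szE exprS mulN1r mulNr.
by rewrite -[[:: val y, val x & _]]/([:: val y] ++ val x :: vals T)
  flagdet_move expr1 mulN1r mulrN opprK.
Qed.

(** Up to the minor on S, adjoining one or two rows gives a minor of size 1 or 2 of the Schur
    complement. With k the size of S, [w0] and [w1] are its columns n - k - 2 and n - k - 1, the
    last ones before the k columns of that minor. *)
Lemma flagdet_schur {R : fieldType} {n : nat} (M : 'M[R]_n) (S : seq nat) :
  (size S + 2 <= n)%N -> flagdet M S != 0 -> exists w0 w1 : nat -> R,
    (forall x, flagdet M (x :: S) = flagdet M S * w1 x) /\
    (forall x y, flagdet M [:: x, y & S] =
       flagdet M S * (w0 x * w1 y - w1 x * w0 y)).
Proof.
set k := size S => kn D0.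
pose A := \matrix_(i < k, j < k) ent M (nth 0%N S i) (n - k + j)%N.
have uA : A \in unitmx by rewrite unitmxE unitfE.
pose w x c := ent M x c - \sum_(s < k) \sum_(t < k)
  ent M x (n - k + s)%N * invmx A s t * ent M (nth 0%N S t) c.
exists (fun x => w x (n - k - 2)%N), (fun x => w x (n - k - 1)%N); split.
  move=> x; rewrite /flagdet -/k -[size (x :: S)]/(1 + k)%N.
  set F := fun i j : nat => _.
  have FA : \matrix_(i < k, j < k) F (1 + i)%N (1 + j)%N = A.
    apply/matrixP => i j; rewrite !mxE /F add1n /=; congr ent.
    by have := ltn_ord j; lia.
  rewrite (@mdet_schur _ 1 k) ?FA //; congr (_ * _).
  rewrite /mdet det_mx11 mxE /w {1}/F /= addn0; congr (ent _ _ _ - _); first lia.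
  apply: eq_bigr => s _; apply: eq_bigr => t _; rewrite /F /=.
  by congr (_ * _ * _); congr ent; first [by []|lia].
move=> x y; rewrite /flagdet -/k -[size [:: x, y & S]]/(2 + k)%N.
set F := fun i j : nat => _.
have FA : \matrix_(i < k, j < k) F (2 + i)%N (2 + j)%N = A.
  apply/matrixP => i j; rewrite !mxE /F /=; congr ent.
  by have := ltn_ord j; lia.
rewrite (@mdet_schur _ 2 k) ?FA //; congr (_ * _).
have wE i j z : nth 0%N [:: x, y & S] i = z -> (i < 2)%N ->
    F i j - \sum_(s < k) \sum_(t < k) F i (2 + s)%N * invmx A s t * F (2 + t)%N j
    = w z (n - k - 2 + j)%N.
  move=> zE i2; rewrite /w /F zE; congr (ent _ _ _ - _); first lia.
  apply: eq_bigr => s _; apply: eq_bigr => t _ /=.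
  by congr (_ * _ * _); congr ent; first [by []|lia].
rewrite /mdet (expand_det_row _ ord0) !big_ord_recl big_ord0 addr0.
rewrite /cofactor !det_mx11 !mxE /= !(wE 0 _ x) ?(wE 1 _ y) //=.
rewrite addn0 expr0 mul1r expr1 mulN1r mulrN.
have -> : (n - k - 2 + bump 0 0 = n - k - 1)%N by rewrite /bump; lia.
by [].
Qed.

(** In terms of [w0] and [w1] this is the three-term identity of 2 x 2 minors, times common signs
    and the square of the minor on T. *)
Lemma row_flag_minor_plucker {R : realType} {n : nat} (M : 'M[R]_n)
    (T : {set 'I_n}) (a b c : 'I_n) :
  (a < b)%N -> (b < c)%N -> a \notin T -> b \notin T -> c \notin T ->
  row_flag_minor M T != 0 ->
  row_flag_minor M (b |: T) * row_flag_minor M (a |: (c |: T)) =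
  row_flag_minor M (a |: T) * row_flag_minor M (b |: (c |: T)) +
  row_flag_minor M (a |: (b |: T)) * row_flag_minor M (c |: T).
Proof.
move=> ab bc aT bT cT; have ac := ltn_trans ab bc.
rewrite !row_flag_minorE !flagdet_setU2 // !flagdet_setU1 // => D0.
have kn : (size (vals T) + 2 <= n)%N.
  rewrite size_vals; have : (#|a |: (b |: T)| <= n)%N by exact: card_ord_set.
  have ab' : a \notin b |: T.
    by rewrite !inE negb_or aT andbT; apply: contraTneq ab => ->; rewrite ltnn.
  by rewrite !cardsU1 ab' bT addn2.
have [w0 [w1 [E1 E2]]] := flagdet_schur _ _ kn D0.
by rewrite !E1 !E2; ring.
Qed.

(** * From one context to the complementary one *)

Ltac nonzero_of_pos :=
  repeat (apply/andP; split); apply: lt0r_neq0;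
  repeat first [assumption | apply: addr_gt0 | apply: mulr_gt0].

(** The digits name the elements of the quadruple adjoined to a context. The relations are solved
    for the minors 13, 24, 14, 134 and 124; the eight arguments then become those of
    [rogersl_octagon]. *)
Lemma rogersl_minors {R : realType}
  (d1 d2 d3 d4 d12 d13 d14 d23 d24 d34 d123 d124 d134 d234 : R) :
  0 < d1 -> 0 < d2 -> 0 < d3 -> 0 < d4 -> 0 < d12 -> 0 < d13 -> 0 < d14 ->
  0 < d23 -> 0 < d24 -> 0 < d34 -> 0 < d123 -> 0 < d124 -> 0 < d134 ->
  0 < d234 ->
  d2 * d13 = d1 * d23 + d12 * d3 ->
  d2 * d14 = d1 * d24 + d12 * d4 ->
  d3 * d24 = d2 * d34 + d23 * d4 ->
  d23 * d134 = d13 * d234 + d123 * d34 ->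
  d23 * d124 = d12 * d234 + d123 * d24 ->
  rogersl (d2 * d34 / (d23 * d4)) + rogersl (d12 * d234 / (d123 * d24)) +
  rogersl (d1 * d24 / (d12 * d4)) + rogersl (d14 * d234 / (d124 * d34)) =
  rogersl (d1 * d23 / (d12 * d3)) + rogersl (d13 * d234 / (d123 * d34)) +
  rogersl (d1 * d34 / (d13 * d4)) + rogersl (d12 * d134 / (d123 * d14)).
Proof.
move=> p1 p2 p3 p4 p12 p13 p14 p23 p24 p34 p123 p124 p134 p234.
move=> e123 e124 e234 f124 f134.
have h13 : d13 = (d1 * d23 + d12 * d3) / d2 by rewrite -e123 mulrAC divff ?mul1r ?lt0r_neq0.
have h24 : d24 = (d2 * d34 + d23 * d4) / d3 by rewrite -e234 mulrAC divff ?mul1r ?lt0r_neq0.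
have h14 : d14 = (d1 * d24 + d12 * d4) / d2 by rewrite -e124 mulrAC divff ?mul1r ?lt0r_neq0.
have h134 : d134 = (d13 * d234 + d123 * d34) / d23 by rewrite -f124 mulrAC divff ?mul1r ?lt0r_neq0.
have h124 : d124 = (d12 * d234 + d123 * d24) / d23 by rewrite -f134 mulrAC divff ?mul1r ?lt0r_neq0.
(* The exchange ratios at d3, d2 and d23 of the cluster of interval minors. *)
pose u := d2 * d34 / (d23 * d4); pose v := d1 * d23 / (d12 * d3).
pose w := d3 * d12 * d234 / (d2 * d34 * d123).
have u0 : 0 < u by rewrite !(mulr_gt0, invr_gt0).
have v0 : 0 < v by rewrite !(mulr_gt0, invr_gt0).
have w0 : 0 < w by rewrite !(mulr_gt0, invr_gt0).
have q24 : 0 < d2 * d34 + d23 * d4 by rewrite addr_gt0 ?mulr_gt0.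
have q13 : 0 < d1 * d23 + d12 * d3 by rewrite addr_gt0 ?mulr_gt0.
have := rogersl_octagon _ _ _ u0 v0 w0.
have -> : u * w / (1 + u) = d12 * d234 / (d123 * d24).
  rewrite h24 /u /w; field; nonzero_of_pos.
have -> : v * (1 + u) = d1 * d24 / (d12 * d4).
  by rewrite h24 /u /v; field; nonzero_of_pos.
have -> : w * (1 + v) = d13 * d234 / (d123 * d34).
  by rewrite h13 /v /w; field; nonzero_of_pos.
have -> : u * v / (1 + v) = d1 * d34 / (d13 * d4).
  rewrite h13 /u /v; field; nonzero_of_pos.
have -> : w * (1 + v + u * v) / (1 + u + u * w) = d14 * d234 / (d124 * d34).
  have -> : 1 + v + u * v = d2 * d14 / (d12 * d4).
    by rewrite h14 h24 /u /v; field; nonzero_of_pos.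
  have -> : 1 + u + u * w = d3 * d124 / (d123 * d4).
    by rewrite h124 h24 /u /w; field; nonzero_of_pos.
  by rewrite /w; field; nonzero_of_pos.
have -> : u * (1 + w + v * w) / (1 + v + u * v) = d12 * d134 / (d123 * d14).
  have -> : 1 + v + u * v = d2 * d14 / (d12 * d4).
    by rewrite h14 h24 /u /v; field; nonzero_of_pos.
  have -> : 1 + w + v * w = d23 * d134 / (d123 * d34).
    by rewrite h134 h13 /v /w; field; nonzero_of_pos.
  by rewrite /u; field; nonzero_of_pos.
by [].
Qed.

Definition Yctx {R : realType} {n : nat} (M : 'M[R]_n) (S : {set 'I_n})
    (a b c : 'I_n) : R :=
  let D := row_flag_minor M in
  D (a |: S) * D (b |: (c |: S)) / (D (a |: (b |: S)) * D (c |: S)).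

(** Each of the four triples occurs once on either side, once with and once without the missing
    fourth element in its context. That element is present on the left for p r s and p q r, on the
    right for the other two. *)
Lemma rogersl_Yctx_quad {R : realType} {n : nat} (M : 'M[R]_n) (T : {set 'I_n})
    (p q r s : 'I_n) (l := @rogersl R) :
  (forall I, 0 < row_flag_minor M I) ->
  (p < q)%N -> (q < r)%N -> (r < s)%N ->
  p \notin T -> q \notin T -> r \notin T -> s \notin T ->
  l (Yctx M T q r s) + l (Yctx M (q |: T) p r s) + l (Yctx M T p q s)
    + l (Yctx M (s |: T) p q r) =
  l (Yctx M T p q r) + l (Yctx M (r |: T) p q s) + l (Yctx M T p r s)
    + l (Yctx M (p |: T) q r s).
Proof.
move=> D0 pq qr rs pT qT rT sT.
have pr := ltn_trans pq qr; have qs := ltn_trans qr rs; have ps := ltn_trans pq qs.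
have nin (x y : 'I_n) : (x < y)%N -> x \notin T -> y \notin T ->
    x \notin y |: T /\ y \notin x |: T.
  move=> xy xT yT; rewrite !inE !negb_or xT yT !andbT eq_sym.
  by split; apply: contraTneq xy => ->; rewrite ltnn.
have pl (S : {set 'I_n}) (a b c : 'I_n) : (a < b)%N -> (b < c)%N ->
    a \notin S -> b \notin S -> c \notin S -> _ :=
  fun h1 h2 h3 h4 h5 =>
    row_flag_minor_plucker M S a b c h1 h2 h3 h4 h5 (lt0r_neq0 (D0 S)).
have e123 := pl T p q r pq qr pT qT rT.
have e124 := pl T p q s pq qs pT qT sT.
have e234 := pl T q r s qr rs qT rT sT.
have f124 := pl (r |: T) p q s pq qs (nin _ _ pr pT rT).1
  (nin _ _ qr qT rT).1 (nin _ _ rs rT sT).2.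
have f134 := pl (q |: T) p r s pr rs (nin _ _ pq pT qT).1
  (nin _ _ qr qT rT).2 (nin _ _ qs qT sT).2.
rewrite /Yctx.
(* Adjunctions are sorted in the order p, q, r, s, so that equal minors become syntactically
   equal. *)
have sw (x y : 'I_n) (S : {set 'I_n}) : x |: (y |: S) = y |: (x |: S).
  exact: finset.setUCA.
have swE := (sw q p, sw r p, sw s p, sw r q, sw s q, sw s r).
rewrite !swE in f124; rewrite !swE in f134; rewrite !swE.
rewrite /l; clear pl l; move: (row_flag_minor M) D0 e123 e124 e234 f124 f134.
move=> D D0 e123 e124 e234 f124 f134.
exact: (rogersl_minors _ _ _ _ _ _ _ _ _ _ _ _ _ _ _ _ _ _ _ _ _ _ _ _ _ _ _ _
  e123 e124 e234 f124 f134).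
Qed.

Definition sum3 {R : realType} {n : nat} (F : 'I_n -> 'I_n -> 'I_n -> R) : R :=
  \sum_(a < n) \sum_(b < n) \sum_(c < n | (a < b)%N && (b < c)%N) F a b c.

Lemma sumT_sum3 {R : realType} (n : nat) (F : nat -> nat -> nat -> R) :
  sumT n F = sum3 (fun a b c : 'I_n => F a.+1 b.+1 c.+1).
Proof.
rewrite /sumT /sum3 big_ord_recl big1 => [|b _]; last by rewrite big_pred0.
rewrite add0r; apply: eq_bigr => a _; rewrite big_ord_recl big_pred0 => [|c].
  rewrite add0r; apply: eq_bigr => b _; rewrite big_mkcond big_ord_recl /=.
  by rewrite !andbF add0r -big_mkcond.
by rewrite andbA !andbF.
Qed.

Lemma eq_sum3 {R : realType} {n : nat} (F G : 'I_n -> 'I_n -> 'I_n -> R) :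
  (forall a b c : 'I_n, (a < b)%N -> (b < c)%N -> F a b c = G a b c) ->
  sum3 F = sum3 G.
Proof.
move=> FG; apply: eq_bigr => a _; apply: eq_bigr => b _.
by apply: eq_bigr => c /andP[ab bc]; exact: FG.
Qed.

Lemma sum3B {R : realType} {n : nat} (F G : 'I_n -> 'I_n -> 'I_n -> R) :
  sum3 (fun a b c => F a b c - G a b c) = sum3 F - sum3 G.
Proof.
rewrite /sum3 -sumrB; apply: eq_bigr => a _; rewrite -sumrB.
by apply: eq_bigr => b _; rewrite -sumrB.
Qed.

(* A triple and a fourth index form a quadruple with a marked element. *)
Lemma sum3_quadruples {R : realType} {n : nat}
    (d : 'I_n -> 'I_n -> 'I_n -> 'I_n -> R) :
  (forall x a b c : 'I_n, (a < b)%N -> (b < c)%N -> x \in [:: a; b; c] ->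
    d x a b c = 0) ->
  (forall p q r s : 'I_n, (p < q)%N -> (q < r)%N -> (r < s)%N ->
     d p q r s + d q p r s + d r p q s + d s p q r = 0) ->
  sum3 (fun a b c => \sum_(x < n) d x a b c) = 0.
Proof.
move=> d0 dq.
pose h (p q r s : 'I_n) : R := ([&& p < q, q < r & r < s]%N)%:R.
(* For a < b < c, an x other than a, b, c lies in exactly one of the four gaps, so exactly one
   indicator is 1; for x among a, b, c the value of [d] is 0. *)
have -> : sum3 (fun a b c => \sum_(x < n) d x a b c) =
    \sum_a \sum_b \sum_c \sum_x
      (h x a b c * d x a b c + h a x b c * d x a b c +
       h a b x c * d x a b c + h a b c x * d x a b c).
  apply: eq_bigr => a _; apply: eq_bigr => b _; rewrite big_mkcond /=.
  apply: eq_bigr => c _; case: ifP => [/andP[ab bc]|abc]; last first.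
    rewrite big1 // => x _; rewrite /h.
    suff -> : [&& x < a, a < b & b < c]%N = false.
      suff -> : [&& a < x, x < b & b < c]%N = false.
        suff -> : [&& a < b, b < x & x < c]%N = false.
          suff -> : [&& a < b, b < c & c < x]%N = false.
            by rewrite !mul0r !addr0.
          by lia.
        by lia.
      by lia.
    by lia.
  apply: eq_bigr => x _; rewrite /h ab bc /= !andbT.
  have [xabc|xabc] := boolP (x \in [:: a; b; c]).
    by rewrite (d0 x a b c) // !mulr0 !addr0.
  have neq (y : 'I_n) : y \in [:: a; b; c] -> (x < y)%N = ~~ (y < x)%N.
    move=> yabc; rewrite -leqNgt ltn_neqAle; case: eqP => // xy.
    by move: xabc; rewrite (val_inj xy) yabc.
  have := neq a; have := neq b; have := neq c; rewrite !inE !eqxx !orbT.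
  move=> /(_ isT) nc /(_ isT) nb /(_ isT) na.
  have [xa|ax] := ltnP x a.
    have xb := ltn_trans xa ab; have xc := ltn_trans xb bc.
    rewrite [(a < x)%N]ltnNge (ltnW xa) [(b < x)%N]ltnNge (ltnW xb).
    by rewrite [(c < x)%N]ltnNge (ltnW xc) mul1r !mul0r !addr0.
  have {}ax : (a < x)%N by move: na; rewrite ltnNge ax; case: ltnP.
  rewrite ax mul0r add0r /=.
  have [xb|bx] := ltnP x b.
    have xc := ltn_trans xb bc.
    rewrite [(b < x)%N]ltnNge (ltnW xb) [(c < x)%N]ltnNge (ltnW xc).
    by rewrite mul1r !mul0r !addr0.
  have {}bx : (b < x)%N by move: nb; rewrite ltnNge bx; case: ltnP.
  rewrite bx mul0r add0r /=.
  have [xc|cx] := ltnP x c.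
    by rewrite ltnNge (ltnW xc) mul1r mul0r addr0.
  have {}cx : (c < x)%N by move: nc; rewrite ltnNge cx; case: ltnP.
  by rewrite cx mul0r mul1r add0r.
pose S4 (F : 'I_n -> 'I_n -> 'I_n -> 'I_n -> R) :=
  \sum_p \sum_q \sum_r \sum_s F p q r s.
have S4D F G : S4 F + S4 G = S4 (fun p q r s => F p q r s + G p q r s).
  rewrite /S4 -big_split; apply: eq_bigr => p _.
  rewrite -big_split; apply: eq_bigr => q _.
  by rewrite -big_split; apply: eq_bigr => r _; rewrite -big_split.
(* Exchanges of adjacent summations, which carry the marked index to its sorted position. *)
have S4x F : S4 F = S4 (fun p q r s => F p q s r).
  apply: eq_bigr => p _; apply: eq_bigr => q _; exact: exchange_big.
have S4y F : S4 F = S4 (fun p q r s => F p r q s).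
  apply: eq_bigr => p _; exact: exchange_big.
have S4z F : S4 F = S4 (fun p q r s => F q p r s) by exact: exchange_big.
have E1 : S4 (fun a b c x => h x a b c * d x a b c) =
    S4 (fun p q r s => h p q r s * d p q r s) by rewrite S4x S4y S4z.
have E2 : S4 (fun a b c x => h a x b c * d x a b c) =
    S4 (fun p q r s => h p q r s * d q p r s) by rewrite S4x S4y.
have E3 : S4 (fun a b c x => h a b x c * d x a b c) =
    S4 (fun p q r s => h p q r s * d r p q s) by rewrite S4x.
rewrite -/(S4 (fun a b c x => _)) -!S4D E1 E2 E3 !S4D /S4.
do 4 (rewrite big1 // => ? _).
rewrite -!mulrDr /h; case: and3P => [[pq qr rs]|_]; last by rewrite mul0r.
by rewrite mul1r dq.
Qed.

(** The rows common to the four minors of [Ylo], in 0-based labels; [hi_ctx] is the same for [Ylot].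
    For a < b < c the two are complementary outside a, b, c. *)
Definition lo_ctx {n : nat} (a b c : nat) : {set 'I_n} :=
  [set x : 'I_n | (a < x < b)%N || (c < x)%N].

Definition hi_ctx {n : nat} (a b c : nat) : {set 'I_n} :=
  [set x : 'I_n | (x < a)%N || (b < x < c)%N].

(* Interpolates between the contexts of [Ylo] ([m = 0]) and [Ylot] ([m = n]). *)
Definition mix_ctx {n : nat} (m a b c : nat) : {set 'I_n} :=
  [set x : 'I_n | if (x < m)%N then (x < a)%N || (b < x < c)%N
                  else (a < x < b)%N || (c < x)%N].

(** The threshold of [mix_ctx] moves from 0 to n. A step at x changes the membership of x only, and
    the changes, grouped by quadruples, cancel by [rogersl_Yctx_quad]. *)
Lemma sum_rogersl_ctx {R : realType} {n : nat} (M : 'M[R]_n) :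
  (forall I, 0 < row_flag_minor M I) ->
  sum3 (fun a b c => rogersl (Yctx M (lo_ctx a b c) a b c)) =
  sum3 (fun a b c => rogersl (Yctx M (hi_ctx a b c) a b c)).
Proof.
move=> D0; apply/esym/eqP; rewrite -subr_eq0 -sum3B; apply/eqP.
pose g (m : nat) (a b c : 'I_n) := rogersl (Yctx M (mix_ctx m a b c) a b c).
pose d (x a b c : 'I_n) := g x.+1 a b c - g x a b c.
rewrite -[RHS](@sum3_quadruples _ _ d).
- apply: eq_sum3 => a b c _ _; rewrite /d -(big_mkord xpredT (fun x => g x.+1 a b c - g x a b c)).
  rewrite telescope_sumr // /g; congr (rogersl (Yctx M _ a b c) - rogersl (Yctx M _ a b c)).
  by apply/setP => x; rewrite !inE ltn_ord.
(* The elements a, b, c belong to no context, so the threshold passes them without effect. *)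
- move=> x a b c ab bc; rewrite !inE => xabc; apply/eqP; rewrite /d subr_eq0 /g.
  apply/eqP; congr (rogersl (Yctx M _ a b c)); apply/setP => y; rewrite !inE ltnS.
  rewrite leq_eqVlt; case: (ltnP y x) => [|_]; first by rewrite orbT.
  rewrite orbF; case: eqP => // /val_inj ->.
  by case/or3P: xabc => /eqP ->; lia.
move=> p q r s pq qr rs.
(* With the threshold at the missing element, the four triples have the same context T outside the
   quadruple. Passing the threshold inserts the missing element if it is p or r, and removes it if
   it is q or s. *)
pose T : {set 'I_n} := [set x : 'I_n | [|| x < p, q < x < r | s < x]%N].
have pT : p \notin T by rewrite inE; lia.
have qT : q \notin T by rewrite inE; lia.
have rT : r \notin T by rewrite inE; lia.
have sT : s \notin T by rewrite inE; lia.
have eqV (x y : 'I_n) : (x == y) = (x == y :> nat) by [].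
have -> : d p q r s = rogersl (Yctx M (p |: T) q r s) - rogersl (Yctx M T q r s).
  rewrite /d /g; congr (rogersl (Yctx M _ q r s) - rogersl (Yctx M _ q r s));
    apply/setP => x; rewrite !inE ?eqV; case: ifP; lia.
have -> : d q p r s = rogersl (Yctx M T p r s) - rogersl (Yctx M (q |: T) p r s).
  rewrite /d /g; congr (rogersl (Yctx M _ p r s) - rogersl (Yctx M _ p r s));
    apply/setP => x; rewrite !inE ?eqV; case: ifP; lia.
have -> : d r p q s = rogersl (Yctx M (r |: T) p q s) - rogersl (Yctx M T p q s).
  rewrite /d /g; congr (rogersl (Yctx M _ p q s) - rogersl (Yctx M _ p q s));
    apply/setP => x; rewrite !inE ?eqV; case: ifP; lia.
have -> : d s p q r = rogersl (Yctx M T p q r) - rogersl (Yctx M (s |: T) p q r).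
  rewrite /d /g; congr (rogersl (Yctx M _ p q r) - rogersl (Yctx M _ p q r));
    apply/setP => x; rewrite !inE ?eqV; case: ifP; lia.
have := rogersl_Yctx_quad _ _ _ _ _ _ D0 pq qr rs pT qT rT sT.
by lra.
Qed.

(** * Reflections and solid minors *)

Definition rev_set {n : nat} (I : {set 'I_n}) : {set 'I_n} :=
  [set x | rev_ord x \in I].

Lemma rev_setU1 {n : nat} (I : {set 'I_n}) (x : 'I_n) :
  rev_set (x |: I) = rev_ord x |: rev_set I.
Proof. by apply/setP => y; rewrite !inE (can2_eq rev_ordK rev_ordK). Qed.

Lemma vals_rev_set {n : nat} (I : {set 'I_n}) :
  vals (rev_set I) = rev [seq (n - x.+1)%N | x <- vals I].
Proof.
apply: valsE.
- rewrite rev_sorted sorted_map; apply: sub_in_sorted (vals_sorted I) => //.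
  move=> x y /vals_lt xn /vals_lt yn /=; lia.
- move=> x; rewrite mem_rev => /mapP[y /vals_lt yn ->]; lia.
move=> i; rewrite mem_rev inE -mem_vals; apply/mapP/idP => [[x xI iE]|iI].
  suff -> : val (rev_ord i) = x by [].
  by have := vals_lt _ _ xI; rewrite /= iE; lia.
by exists (val (rev_ord i)) => //=; have := ltn_ord i; lia.
Qed.

Lemma nth_vals_rev_set {n : nat} (I : {set 'I_n}) (i : nat) : (i < #|I|)%N ->
  nth 0%N (vals (rev_set I)) i = (n - (nth 0%N (vals I) (#|I| - i.+1)).+1)%N.
Proof.
move=> iI; rewrite vals_rev_set nth_rev size_map size_vals //.
by rewrite (nth_map 0%N) // size_vals; lia.
Qed.

Lemma card_rev_set {n : nat} (I : {set 'I_n}) : #|rev_set I| = #|I|.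
Proof. by rewrite -!size_vals vals_rev_set size_rev size_map. Qed.

(** Reflection in the antidiagonal: it turns first rows into last columns while preserving upper
    triangularity. *)
Definition anti_transpose {R : comNzRingType} {n : nat} (M : 'M[R]_n) : 'M[R]_n :=
  \matrix_(i, j) M (rev_ord j) (rev_ord i).

Lemma ent_anti_transpose {R : comNzRingType} {n : nat} (M : 'M[R]_n) (i j : nat) :
  (i < n)%N -> (j < n)%N ->
  ent (anti_transpose M) i j = ent M (n - j.+1)%N (n - i.+1)%N.
Proof.
move=> ni nj; rewrite -[i]/(val (Ordinal ni)) -[j]/(val (Ordinal nj)) entE mxE.
by rewrite -entE.
Qed.

Lemma nth_vals_lt {n : nat} (I : {set 'I_n}) (i : nat) : (i < #|I|)%N ->
  (nth 0%N (vals I) i < n)%N.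
Proof. by move=> iI; apply: (@vals_lt _ I); rewrite mem_nth // size_vals. Qed.

Lemma col_flag_minor_anti {R : realType} {n : nat} (M : 'M[R]_n) (J : {set 'I_n}) :
  col_flag_minor M J = row_flag_minor (anti_transpose M) (rev_set J).
Proof.
rewrite col_flag_minorE row_flag_minorE /coflagdet /flagdet !size_vals card_rev_set.
rewrite -[LHS]mdet_tr -[LHS]mdet_rev; apply: eq_mdet => i j iJ jJ.
have kn := card_ord_set J.
have im : (#|J| - i.+1 < #|J|)%N by lia.
have := nth_vals_lt _ _ im.
rewrite nth_vals_rev_set // => vn.
rewrite ent_anti_transpose; [|lia|lia].
by congr ent; lia.
Qed.

(** * Flag minors under the factorization that defines M' and M'' *)

Lemma antidiag_mulmx {R : realType} {n : nat} (M : 'M[R]_n) (i j : 'I_n) :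
  (antidiag R n *m M) i j = M (rev_ord i) j.
Proof.
rewrite mxE (bigD1 (rev_ord i)) //= big1 ?addr0 => [|k ki].
  by rewrite mxE /= (_ : _ == _) ?mul1r //; have := ltn_ord i; lia.
rewrite mxE (_ : _ == _ = false) ?mul0r //; apply: contraNF ki => /eqP kE.
by apply/eqP/val_inj => /=; lia.
Qed.

Lemma mulmx_antidiag {R : realType} {n : nat} (M : 'M[R]_n) (i j : 'I_n) :
  (M *m antidiag R n) i j = M i (rev_ord j).
Proof.
rewrite mxE (bigD1 (rev_ord j)) //= big1 ?addr0 => [|k kj].
  by rewrite mxE /= (_ : _ == _) ?mulr1 //; have := ltn_ord j; lia.
rewrite mxE (_ : _ == _ = false) ?mulr0 //; apply: contraNF kj => /eqP kE.
by apply/eqP/val_inj => /=; lia.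
Qed.

(** The Cauchy-Binet sum has a single term: P M P = M1 K with K = P D M2, and the first k columns of
    K are supported in its last k rows. The factor depends on I only through its size. *)
Lemma row_flag_minor_prime {R : realType} {n : nat} (M M1 M2 D : 'M[R]_n) :
  is_trig_mx M2^T -> is_diag_mx D ->
  antidiag R n *m M *m antidiag R n = M1 *m antidiag R n *m D *m M2 ->
  exists kappa : nat -> R, forall I,
    row_flag_minor M (rev_set I) = row_flag_minor M1 I * kappa #|I|.
Proof.
move=> /is_trig_mxP M2t /is_diag_mxP Dd ME; pose K := antidiag R n *m D *m M2.
have {}ME : antidiag R n *m M *m antidiag R n = M1 *m K by rewrite ME !mulmxA.
have K0 (x c : 'I_n) : (x + c.+1 < n)%N -> K x c = 0.
  move=> xc; rewrite /K -mulmxA antidiag_mulmx mxE big1 // => y _.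
  have [yx|yx] := eqVneq (rev_ord x) y; last by rewrite Dd ?mul0r.
  have := M2t c y; rewrite mxE => -> //; first by rewrite mulr0.
  by rewrite -yx /=; lia.
(* The minor of [K] on the last k rows and the first k columns. *)
exists (fun k => mdet k (fun i j => ent K (n - k + i)%N j)) => I.
rewrite !row_flag_minorE /flagdet !size_vals card_rev_set; set k := #|I|.
have kn : (k <= n)%N by exact: card_ord_set.
rewrite -[LHS]mdet_rev -det_mulmx; congr (\det _); apply/matrixP => i j.
rewrite !mxE; have ik := ltn_ord i; have jk := ltn_ord j.
have rn : (nth 0%N (vals I) i < n)%N by exact: nth_vals_lt.
have cn : (j < n)%N by lia.
rewrite nth_vals_rev_set -/k; last by lia.
rewrite (_ : k - (k - i.+1).+1 = i)%N; last by lia.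
pose r := Ordinal rn; pose c := Ordinal cn.
have -> : ent M (n - (nth 0%N (vals I) i).+1)%N (n - k + (k - j.+1))%N =
    (M1 *m K) r c.
  rewrite -ME mulmx_antidiag antidiag_mulmx -entE; congr ent => /=; lia.
rewrite mxE; under eq_bigr do rewrite -!entE /=.
rewrite -(big_mkord xpredT (fun x => ent M1 (nth 0%N (vals I) i) x * ent K x j)).
rewrite (big_cat_nat (n := n - k)) ?leq_subr //= big1_seq ?add0r; last first.
  move=> x; rewrite mem_index_iota => /andP[_ /andP[_ xk]].
  have xn : (x < n)%N by lia.
  rewrite -[x]/(val (Ordinal xn)) -[X in ent K _ X]/(val c) entE K0 ?mulr0 //=.
  by lia.
rewrite -{1}[(n - k)%N]add0n big_addn subKn // big_mkord.
by apply: eq_bigr => x _; rewrite !mxE addnC.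
Qed.

(** * Solid minors of unipotent matrices *)

Lemma vals_iota2 {n : nat} (I : {set 'I_n}) (a k c l : nat) :
  (a + k <= c)%N -> (c + l <= n)%N ->
  (forall i : 'I_n, (i \in I) = (a <= i < a + k)%N || (c <= i < c + l)%N) ->
  vals I = iota a k ++ iota c l.
Proof.
move=> akc cln IE; apply: valsE => [|x|i]; last by rewrite mem_cat !mem_iota IE.
  rewrite (sorted_pairwise ltn_trans) pairwise_cat.
  rewrite -!(sorted_pairwise ltn_trans) !iota_ltn_sorted !andbT.
  by apply/allrelP => x y; rewrite !mem_iota /=; lia.
by rewrite mem_cat !mem_iota; lia.
Qed.

Lemma ent_upper {R : realType} {n : nat} (M : 'M[R]_n) (i j : nat) :
  in_N M -> (j < i)%N -> ent M i j = 0.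
Proof.
move=> [[/is_trig_mxP Mt _] _] ji; rewrite /ent.
case: insubP => // i' _ iE; case: insubP => // j' _ jE.
by have := Mt j' i'; rewrite mxE; apply; rewrite iE jE.
Qed.

Lemma ent_diag {R : realType} {n : nat} (M : 'M[R]_n) (i : nat) :
  in_N M -> (i < n)%N -> ent M i i = 1.
Proof. by move=> [_ M1] ni; rewrite -[i]/(val (Ordinal ni)) entE M1. Qed.

Definition solid_minor {R : realType} {n : nat} (M : 'M[R]_n) (i j k : nat) : R :=
  mdet k (fun x y => ent M (i + x)%N (j + y)%N).

(** The submatrix is block upper triangular, and its block on the rows and columns from r on is
    unipotent. What remains are the rows p to q and as many columns just before r; p = q + 1 encodes
    an empty interval. *)
Lemma row_flag_minor_solid {R : realType} {n : nat} (M : 'M[R]_n) (p q r : nat) :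
  in_N M -> (0 < p)%N -> (p <= q.+1)%N -> (q < r)%N -> (r <= n.+1)%N ->
  row_flag_minor M (ivl n p q :|: ivl n r n) =
  solid_minor M p.-1 (r.-1 - (q.+1 - p))%N (q.+1 - p)%N.
Proof.
move=> MN p0 pq qr rn; set k := (q.+1 - p)%N.
rewrite row_flag_minorE (@vals_iota2 _ _ p.-1 k r.-1 (n - r.-1)%N); first last.
- by move=> i; rewrite !inE; have := ltn_ord i; lia.
- by lia.
- by lia.
rewrite /flagdet size_cat !size_iota mdet_ublock => [|i j ik jk]; last first.
  rewrite nth_cat size_iota ltnNge leq_addr /= addKn nth_iota //.
  by rewrite ent_upper //; lia.
rewrite (mdet_unitriangular (n - r.-1)%N) ?mulr1; first last.
- move=> i ir; rewrite nth_cat size_iota ltnNge leq_addr /= addKn nth_iota //.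
  by rewrite (_ : n - _ + _ = r.-1 + i)%N ?ent_diag //; lia.
- move=> i j /andP[ji ir].
  rewrite nth_cat size_iota ltnNge leq_addr /= addKn nth_iota //.
  by rewrite ent_upper //; lia.
apply: eq_mdet => i j ik jk; rewrite nth_cat size_iota ik nth_iota //.
by congr ent; lia.
Qed.

(** Here the unipotent block is the upper left one, on the first a rows and columns. *)
Lemma col_flag_minor_solid {R : realType} {n : nat} (M : 'M[R]_n) (a b c : nat) :
  in_N M -> (a < b)%N -> (b <= c.+1)%N -> (c <= n)%N ->
  col_flag_minor M (ivl n 1 a :|: ivl n b c) =
  solid_minor M a b.-1 (c.+1 - b)%N.
Proof.
move=> MN ab bc cn; set k := (c.+1 - b)%N.
rewrite col_flag_minorE (@vals_iota2 _ _ 0 a b.-1 k); first last.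
- by move=> i; rewrite !inE; lia.
- by lia.
- by lia.
rewrite /coflagdet size_cat !size_iota mdet_ublock => [|i j ik jk]; last first.
  by rewrite nth_cat size_iota jk nth_iota // ent_upper //; lia.
rewrite (mdet_unitriangular a) ?mul1r; first last.
- by move=> i ia; rewrite nth_cat size_iota ia nth_iota // ent_diag //; lia.
- move=> i j /andP[ji ia].
  by rewrite nth_cat size_iota (ltn_trans ji ia) nth_iota ?(ltn_trans ji ia) // ent_upper.
apply: eq_mdet => i j ik jk.
by rewrite nth_cat size_iota ltnNge leq_addr /= addKn nth_iota.
Qed.

(** All the minors are solid, and comparing their corners and sizes gives the substitution of a + c
    - b for b, with the two factors above and below exchanged. *)
Lemma Yupt_Ylo {R : realType} {n : nat} (M : 'M[R]_n) (a b c : nat) :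
  in_N M -> (0 < a)%N -> (a < b)%N -> (b < c)%N -> (c <= n)%N ->
  Yupt M a b c = Ylo M a (a + c - b)%N c.
Proof.
move=> MN a0 ab bc cn; rewrite /Yupt /Ylo.
rewrite !col_flag_minor_solid // ?row_flag_minor_solid //; try lia.
rewrite [X in X / _]mulrC [X in _ / X]mulrC.
by congr (_ * _ / (_ * _)); congr solid_minor; lia.
Qed.

Lemma sumT_reflect {R : realType} (n : nat) (F : nat -> nat -> nat -> R) :
  sumT n (fun a b c => F a (a + c - b)%N c) = sumT n F.
Proof.
(* With b summed innermost, the substitution reverses the interval between a and c. *)
have E G : sumT n G = \sum_(a < n.+1) \sum_(c < n.+1 | (0 < a)%N)
    \sum_(a.+1 <= b < c) G a b c.
  apply: eq_bigr => a _; rewrite (exchange_big_dep xpredT) //= [RHS]big_mkcond /=.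
  apply: eq_bigr => c _; case: (posnP a) => [->|a0]; first by rewrite big_pred0.
  rewrite (big_nat_widen _ _ n.+1) ?(ltnW (ltn_ord c)) //.
  rewrite (big_nat_widenl _ 0) // big_mkord.
  by apply: eq_bigl => b /=; rewrite andbC.
rewrite !E; apply: eq_bigr => a _; apply: eq_bigr => c _.
rewrite [RHS]big_nat_rev /=; apply: eq_bigr => b _.
by congr F; lia.
Qed.

(** * The four families as values of [Yctx] *)

Lemma ord_eqE {n : nat} (x y : 'I_n) : (x == y) = (x == y :> nat).
Proof. by []. Qed.

Lemma Ylo_ctx {R : realType} {n : nat} (M : 'M[R]_n) (a b c : 'I_n) :
  (a < b)%N -> (b < c)%N -> Ylo M a.+1 b.+1 c.+1 = Yctx M (lo_ctx a b c) a b c.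
Proof.
move=> ab bc; rewrite /Ylo /Yctx.
by congr (_ * _ / (_ * _)); congr row_flag_minor; apply/setP => x;
  rewrite !inE !ord_eqE; have := ltn_ord x; lia.
Qed.

Lemma Ylot_ctx {R : realType} {n : nat} (M : 'M[R]_n) (a b c : 'I_n) :
  (a < b)%N -> (b < c)%N -> Ylot M a.+1 b.+1 c.+1 = Yctx M (hi_ctx a b c) a b c.
Proof.
move=> ab bc; rewrite /Ylot /Yctx.
by congr (_ * _ / (_ * _)); congr row_flag_minor; apply/setP => x;
  rewrite !inE !ord_eqE; have := ltn_ord x; lia.
Qed.

(** The reflection reverses the triple, so a and c exchange roles and a context of the lower kind
    becomes one of the upper kind. *)
Lemma Yup_ctx {R : realType} {n : nat} (M : 'M[R]_n) (a b c : 'I_n) :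
  (a < b)%N -> (b < c)%N ->
  Yup M a.+1 b.+1 c.+1 = Yctx (anti_transpose M)
    (hi_ctx (rev_ord c) (rev_ord b) (rev_ord a)) (rev_ord c) (rev_ord b) (rev_ord a).
Proof.
move=> ab bc; rewrite /Yup /Yctx !col_flag_minor_anti.
rewrite [X in X / _]mulrC [X in _ / X]mulrC.
by congr (_ * _ / (_ * _)); congr row_flag_minor; apply/setP => x;
  rewrite !inE !ord_eqE /=; have := ltn_ord x; have := ltn_ord c; lia.
Qed.

Lemma Yupt_ctx {R : realType} {n : nat} (M : 'M[R]_n) (a b c : 'I_n) :
  (a < b)%N -> (b < c)%N ->
  Yupt M a.+1 b.+1 c.+1 = Yctx (anti_transpose M)
    (lo_ctx (rev_ord c) (rev_ord b) (rev_ord a)) (rev_ord c) (rev_ord b) (rev_ord a).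
Proof.
move=> ab bc; rewrite /Yupt /Yctx !col_flag_minor_anti.
rewrite [X in X / _]mulrC [X in _ / X]mulrC.
by congr (_ * _ / (_ * _)); congr row_flag_minor; apply/setP => x;
  rewrite !inE !ord_eqE /=; have := ltn_ord x; have := ltn_ord c; lia.
Qed.

Lemma sum3_rev {R : realType} {n : nat} (F : 'I_n -> 'I_n -> 'I_n -> R) :
  sum3 (fun a b c => F (rev_ord c) (rev_ord b) (rev_ord a)) = sum3 F.
Proof.
have E G : sum3 G = \sum_(a < n) \sum_(b < n) \sum_(c < n)
    if (a < b)%N && (b < c)%N then G a b c else 0.
  by apply: eq_bigr => a _; apply: eq_bigr => b _; rewrite big_mkcond.
rewrite !E [RHS](reindex_inj rev_ord_inj) /=.
under [RHS]eq_bigr do rewrite (reindex_inj rev_ord_inj) /=.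
under [RHS]eq_bigr do under eq_bigr do rewrite (reindex_inj rev_ord_inj) /=.
under [LHS]eq_bigr do rewrite exchange_big.
rewrite exchange_big; apply: eq_bigr => c _.
rewrite exchange_big; apply: eq_bigr => b _; apply: eq_bigr => a _.
congr (if _ then _ else _).
by have := ltn_ord a; have := ltn_ord b; have := ltn_ord c; lia.
Qed.

Lemma sumT_Yup {R : realType} {n : nat} (g : R -> R) (M : 'M[R]_n) :
  sumT n (fun a b c => g (Yup M a b c)) =
  sumT n (fun a b c => g (Ylot (anti_transpose M) a b c)).
Proof.
rewrite !sumT_sum3 -[RHS]sum3_rev; apply: eq_sum3 => a b c ab bc.
rewrite Yup_ctx // Ylot_ctx //=; have := ltn_ord c; have := ltn_ord b; lia.
Qed.

Lemma sumT_Yupt {R : realType} {n : nat} (g : R -> R) (M : 'M[R]_n) :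
  sumT n (fun a b c => g (Yupt M a b c)) =
  sumT n (fun a b c => g (Ylo (anti_transpose M) a b c)).
Proof.
rewrite !sumT_sum3 -[RHS]sum3_rev; apply: eq_sum3 => a b c ab bc.
rewrite Yupt_ctx // Ylo_ctx //=; have := ltn_ord c; have := ltn_ord b; lia.
Qed.

(** * Equality of the four families and comparison of M with M' and M'' *)

Definition flag_positive {R : realType} {n : nat} (M : 'M[R]_n) : Prop :=
  forall I, 0 < row_flag_minor M I.

Lemma rev_setK {n : nat} (I : {set 'I_n}) : rev_set (rev_set I) = I.
Proof. by apply/setP => x; rewrite !inE rev_ordK. Qed.

(** The row flag minors of the reflected matrix are column flag minors of M. *)
Lemma flag_positive_Npos {R : realType} {n : nat} (M : 'M[R]_n) :
  in_Npos M -> flag_positive M /\ flag_positive (anti_transpose M).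
Proof.
move=> [_ MP]; split=> I; first exact: row_flag_minor_gt0.
by rewrite -[I]rev_setK -col_flag_minor_anti; exact: col_flag_minor_gt0.
Qed.

Lemma sumT_Ylo_Ylot {R : realType} {n : nat} (M : 'M[R]_n) : flag_positive M ->
  sumT n (fun a b c => rogersl (Ylo M a b c)) =
  sumT n (fun a b c => rogersl (Ylot M a b c)).
Proof.
move=> MP; rewrite !sumT_sum3; transitivity
  (sum3 (fun a b c => rogersl (Yctx M (lo_ctx a b c) a b c))).
  by apply: eq_sum3 => a b c ab bc; rewrite Ylo_ctx.
rewrite sum_rogersl_ctx //.
by apply: eq_sum3 => a b c ab bc; rewrite Ylot_ctx.
Qed.

Lemma Ylo_gt0 {R : realType} {n : nat} (M : 'M[R]_n) (a b c : nat) :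
  flag_positive M -> 0 < Ylo M a b c.
Proof. by move=> MP; rewrite !(mulr_gt0, invr_gt0). Qed.

Lemma Ylot_gt0 {R : realType} {n : nat} (M : 'M[R]_n) (a b c : nat) :
  flag_positive M -> 0 < Ylot M a b c.
Proof. by move=> MP; rewrite !(mulr_gt0, invr_gt0). Qed.

(** Termwise l (1 / F) = C - l (F), and both sums run over the same triples. *)
Lemma sumT_rogersl_inv {R : realType} (n : nat) (F G : nat -> nat -> nat -> R) :
  (forall a b c, 0 < F a b c) -> (forall a b c, 0 < G a b c) ->
  sumT n (fun a b c => rogersl (F a b c)) = sumT n (fun a b c => rogersl (G a b c)) ->
  sumT n (fun a b c => rogersl (1 / F a b c)) =
  sumT n (fun a b c => rogersl (1 / G a b c)).
Proof.
move=> F0 G0; have [C lC] := @rogersl_inv R.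
have E H : (forall a b c, 0 < H a b c) ->
    sumT n (fun a b c => rogersl (1 / H a b c)) =
    sumT n (fun _ _ _ => C) - sumT n (fun a b c => rogersl (H a b c)).
  move=> H0; rewrite !sumT_sum3 -sum3B; apply: eq_sum3 => a b c _ _.
  by rewrite -(lC (H a.+1 b.+1 c.+1)) // [RHS]addrC addKr.
by move=> FG; rewrite (E F F0) (E G G0) FG.
Qed.

Lemma anti_transposeE {R : realType} {n : nat} (M : 'M[R]_n) :
  anti_transpose M = antidiag R n *m M^T *m antidiag R n.
Proof. by apply/matrixP => i j; rewrite mulmx_antidiag antidiag_mulmx !mxE. Qed.

Lemma antidiagK {R : realType} (n : nat) : antidiag R n *m antidiag R n = 1%:M.
Proof.
apply/matrixP => i j; rewrite mulmx_antidiag !mxE; congr (_%:R); rewrite ord_eqE /=.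
by congr nat_of_bool; apply/eqP/eqP; have := ltn_ord i; have := ltn_ord j; lia.
Qed.

Lemma tr_antidiag {R : realType} (n : nat) : (antidiag R n)^T = antidiag R n.
Proof. by apply/matrixP => i j; rewrite !mxE addnC. Qed.

(** Transposition reverses the factorization, so M1 and M2 exchange roles; D, being diagonal, is
    symmetric. *)
Lemma anti_transpose_prime {R : realType} {n : nat} (M M1 M2 D : 'M[R]_n) :
  is_diag_mx D ->
  antidiag R n *m M *m antidiag R n = M1 *m antidiag R n *m D *m M2 ->
  antidiag R n *m anti_transpose M *m antidiag R n =
  anti_transpose M2 *m antidiag R n *m D *m anti_transpose M1.
Proof.
move=> Dd /(congr1 (fun X => antidiag R n *m X^T *m antidiag R n)).
have DT : D^T = D.
  apply/matrixP => i j; rewrite mxE; have [->//|ij] := eqVneq i j.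
  by move/is_diag_mxP: Dd => Dd; rewrite !Dd // eq_sym.
rewrite !trmx_mul !tr_antidiag DT !anti_transposeE !mulmxA => ->.
by rewrite -[X in _ = X *m D *m _ *m _ *m _]mulmxA antidiagK mulmx1.
Qed.

(** Numerator and denominator both contain one minor of size |S| + 1 and one of size |S| + 2, so the
    factors [kappa] cancel. The reversal of the triple inverts the ratio. *)
Lemma Yctx_prime {R : realType} {n : nat} (M M1 : 'M[R]_n) (kappa : nat -> R)
    (S : {set 'I_n}) (a b c : 'I_n) :
  flag_positive M -> flag_positive M1 ->
  (forall I, row_flag_minor M (rev_set I) = row_flag_minor M1 I * kappa #|I|) ->
  (a < b)%N -> (b < c)%N -> a \notin S -> b \notin S -> c \notin S ->
  Yctx M1 S a b c =
  1 / Yctx M (rev_set S) (rev_ord c) (rev_ord b) (rev_ord a).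
Proof.
move=> MP M1P ME ab bc aS bS cS.
have neq (x y : 'I_n) : (x < y)%N -> x != y by move=> xy; rewrite ord_eqE ltn_eqF.
have kE (x : 'I_n) : x \notin S -> #|x |: S| = #|S|.+1.
  by move=> xS; rewrite cardsU1 xS.
have kE2 (x y : 'I_n) : (x < y)%N -> x \notin S -> y \notin S ->
    #|x |: (y |: S)| = #|S|.+2.
  by move=> xy xS yS; rewrite cardsU1 kE // !inE negb_or neq // xS.
have kappa0 I : kappa #|I : {set 'I_n}| != 0.
  by have := lt0r_neq0 (MP (rev_set I)); rewrite ME mulf_eq0 negb_or => /andP[].
have := kappa0 (b |: (c |: S)); have := kappa0 (c |: S).
rewrite /Yctx -!rev_setU1 !ME.
rewrite (finset.setUCA [set b] [set a]) (finset.setUCA [set c] [set b]).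
rewrite !kE // !kE2 // => k1 k2.
have := lt0r_neq0 (M1P (a |: S)); have := lt0r_neq0 (M1P (b |: (c |: S))).
have := lt0r_neq0 (M1P (a |: (b |: S))); have := lt0r_neq0 (M1P (c |: S)).
move: (row_flag_minor M1) => D d1 d2 d3 d4.
by field; rewrite d1 d2 d3 d4 k1 k2.
Qed.

(** Reflection maps [lo_ctx] to [hi_ctx] of the reversed triple, so [Yctx_prime] matches the two
    sums termwise after [sum3_rev]. *)
Lemma sumT_prime {R : realType} {n : nat} (g : R -> R) (M M1 M2 D : 'M[R]_n) :
  flag_positive M -> flag_positive M1 -> is_trig_mx M2^T -> is_diag_mx D ->
  antidiag R n *m M *m antidiag R n = M1 *m antidiag R n *m D *m M2 ->
  sumT n (fun a b c => g (Ylo M1 a b c)) =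
  sumT n (fun a b c => g (1 / Ylot M a b c)).
Proof.
move=> MP M1P M2t Dd /(row_flag_minor_prime _ _ _ _ M2t Dd)[kappa kE].
rewrite !sumT_sum3 -[RHS]sum3_rev; apply: eq_sum3 => a b c ab bc.
rewrite Ylo_ctx // (Yctx_prime _ _ _ _ _ _ _ MP M1P kE) //.
- rewrite Ylot_ctx /=; [|have := ltn_ord c; lia|have := ltn_ord b; lia].
  congr (g (1 / Yctx M _ _ _ _)); apply/setP => x; rewrite !inE /=.
  by have := ltn_ord x; have := ltn_ord c; lia.
- by rewrite inE; lia.
- by rewrite inE; lia.
- by rewrite inE; lia.
Qed.

Lemma sumT_Y_families {R : realType} {n : nat} (M : 'M[R]_n) (l := @rogersl R) :
  in_Npos M ->
  [/\ sumT n (fun a b c => l (Ylo M a b c)) = sumT n (fun a b c => l (Yupt M a b c)),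
      sumT n (fun a b c => l (Ylo M a b c)) = sumT n (fun a b c => l (Ylot M a b c)) &
      sumT n (fun a b c => l (Ylo M a b c)) = sumT n (fun a b c => l (Yup M a b c))].
Proof.
move=> MN; have [MP MP'] := flag_positive_Npos _ MN.
have E : sumT n (fun a b c => l (Ylo M a b c)) = sumT n (fun a b c => l (Yupt M a b c)).
  rewrite -sumT_reflect !sumT_sum3; apply: eq_sum3 => a b c ab bc.
  by rewrite Yupt_Ylo //; case: MN.
split => //; first exact: sumT_Ylo_Ylot.
(* [Yup] is reached through [Yupt]: on the reflected matrix the two are [Ylot] and [Ylo]. *)
by rewrite E sumT_Yupt sumT_Yup sumT_Ylo_Ylot.
Qed.

Lemma sumT_Yinv_families {R : realType} {n : nat} (M : 'M[R]_n) (l := @rogersl R) :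
  in_Npos M ->
  [/\ sumT n (fun a b c => l (1 / Ylo M a b c)) =
        sumT n (fun a b c => l (1 / Yupt M a b c)),
      sumT n (fun a b c => l (1 / Ylo M a b c)) =
        sumT n (fun a b c => l (1 / Ylot M a b c)) &
      sumT n (fun a b c => l (1 / Ylo M a b c)) =
        sumT n (fun a b c => l (1 / Yup M a b c))].
Proof.
move=> MN; have [MP MP'] := flag_positive_Npos _ MN.
have [E1 E2 E3] := sumT_Y_families _ MN.
split.
(* The reflection expresses the family by row flag minors, whose ratios are known to be positive. *)
- rewrite (sumT_Yupt (fun y => l (1 / y))).
  apply: sumT_rogersl_inv => [a b c|a b c|]; [exact: Ylo_gt0..|].
  by rewrite E1 sumT_Yupt.
- apply: sumT_rogersl_inv => [a b c|a b c|//]; [exact: Ylo_gt0|exact: Ylot_gt0].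
rewrite (sumT_Yup (fun y => l (1 / y))).
apply: sumT_rogersl_inv => [a b c|a b c|]; [exact: Ylo_gt0|exact: Ylot_gt0|].
by rewrite E3 sumT_Yup.
Qed.

Theorem theorem1 (R : realType) (n : nat) (hn : (3 <= n)%N)
    (M M' M'' : 'M[R]_n) (hM : in_Npos M) (hM'M'' : is_prime_pair M M' M'') :
  let l := @rogersl R in
  let s1 := sumT n (fun a b c => l (Ylo M' a b c)) in
  let s2 := sumT n (fun a b c => l (1 / Ylo M a b c)) in
  let s3 := sumT n (fun a b c => l (Ylo M'' a b c)) in
  let s4 := sumT n (fun a b c => l (Yupt M' a b c)) in
  let s5 := sumT n (fun a b c => l (1 / Yupt M a b c)) in
  let s6 := sumT n (fun a b c => l (Yupt M'' a b c)) in
  let s7 := sumT n (fun a b c => l (Ylot M' a b c)) in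
  let s8 := sumT n (fun a b c => l (1 / Ylot M a b c)) in
  let s9 := sumT n (fun a b c => l (Ylot M'' a b c)) in
  let s10 := sumT n (fun a b c => l (Yup M' a b c)) in
  let s11 := sumT n (fun a b c => l (1 / Yup M a b c)) in
  let s12 := sumT n (fun a b c => l (Yup M'' a b c)) in
  s1 = s2 /\ s2 = s3 /\ s3 = s4 /\ s4 = s5 /\ s5 = s6 /\ s6 = s7 /\
  s7 = s8 /\ s8 = s9 /\ s9 = s10 /\ s10 = s11 /\ s11 = s12.
Proof.
move=> l s1 s2 s3 s4 s5 s6 s7 s8 s9 s10 s11 s12.
case: hM'M'' => hM' hM'' [D [Dd ME]].
have [MP MPt] := flag_positive_Npos _ hM.
have [M1P _] := flag_positive_Npos _ hM'.
have [_ M2Pt] := flag_positive_Npos _ hM''.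
have upper (X : 'M[R]_n) : in_Npos X -> is_trig_mx X^T by case=> -[[]].
have anti_upper (X : 'M[R]_n) : in_Npos X -> is_trig_mx (anti_transpose X)^T.
  move=> /upper /is_trig_mxP Xt; apply/is_trig_mxP => i j ij; rewrite !mxE.
  have := Xt (rev_ord j) (rev_ord i); rewrite mxE; apply => /=.
  by have := ltn_ord j; lia.
have [e14 e17 e110] : [/\ s1 = s4, s1 = s7 & s1 = s10] := sumT_Y_families _ hM'.
have [e36 e39 e312] : [/\ s3 = s6, s3 = s9 & s3 = s12] := sumT_Y_families _ hM''.
have [e25 e28 e211] : [/\ s2 = s5, s2 = s8 & s2 = s11] := sumT_Yinv_families _ hM.
(* Within each of M', M'' and M the families already agree. Two bridges remain: from M' to M
   directly, and from M'' to M after reflection. *)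
have e18 : s1 = s8 by exact: (sumT_prime l _ _ _ _ MP M1P (upper _ hM'') Dd ME).
(* In the reflected factorization the reflection of M'' is the first factor and takes the place of
   M'. *)
have e611 : s6 = s11.
  rewrite /s6 (sumT_Yupt l) /s11 (sumT_Yup (fun y => l (1 / y))).
  exact: (sumT_prime l _ _ _ _ MPt M2Pt (anti_upper _ hM') Dd
    (anti_transpose_prime _ _ _ _ Dd ME)).
clearbody s1 s2 s3 s4 s5 s6 s7 s8 s9 s10 s11 s12.
by do !split; congruence.
Qed.
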